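(* Let $m$ be a positive integer and let $Z=mP_1+\cdots+mP_s$ be a set of $s$ non-degenerate equimultiple fat points in $\mathbb P^n$ (with $P_1,\dots,P_s$ distinct). If $s\le n+3$, then $$\operatorname{reg}(Z)=T(Z),$$ where $$T(Z)=\max\{T_j(Z)\mid j=1,\dots,n\},$$ $$T_j(Z)=\max\left\{\left[\frac{mq+j-2}{j}\right]\ \Big|\ P_{i_1},\dots,P_{i_q}\text{ lie on a }j\text{-dimensional linear subspace}\right\}.$$
   Context: $K$ is an algebraically closed field of arbitrary characteristic and $\mathbb P^n=\mathbb P^n_K$, with homogeneous coordinate ring $R=K[X_0,\dots,X_n]$. For distinct points $P_1,\dots,P_s\in\mathbb P^n$ with homogeneous prime ideals $\wp_1,\dots,\wp_s\subset R$ and positive integers $m_1,\dots,m_s$, the set of fat points $Z=m_1P_1+\cdots+m_sP_s$ is the zero-dimensional scheme defined by $I=\wp_1^{m_1}\cap\cdots\cap\wp_s^{m_s}$. It is equimultiple if $m_1=\cdots=m_s$, and non-degenerate in $\mathbb P^n$ if $P_1,\dots,P_s$ span $\mathbb P^n$. The regularity index $\operatorname{reg}(Z)$ is the least integer $t$ such that $\dim_K(R/I)_t=\sum_{i=1}^s\binom{m_i+n-1}{n}$. $[a]$ denotes the integer part of a rational number $a$. In the definition of $T_j(Z)$ the maximum is over all subsets $\{P_{i_1},\dots,P_{i_q}\}$ of $q$ distinct points among $P_1,\dots,P_s$ that are contained in some $j$-dimensional linear subspace of $\mathbb P^n$. *)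

(* Defs.v *)
From HB Require Import structures.
From mathcomp Require Import all_boot all_order all_algebra.
From mathcomp Require Import boolp mpoly.

Set Implicit Arguments.
Unset Strict Implicit.
Unset Printing Implicit Defensive.

Import GRing.Theory.
Local Open Scope ring_scope.

(* Ideals of R = K[X_0, ..., X_n] = {mpoly K[n.+1]} are Prop-valued
   predicates. *)

Section Ideals.
Variables (K : fieldType) (n : nat).
Implicit Types (S I : {mpoly K[n.+1]} -> Prop).

Definition ideal_gen S (f : {mpoly K[n.+1]}) : Prop :=
  exists (k : nat) (a b : 'I_k -> {mpoly K[n.+1]}),
    (forall i, S (b i)) /\ f = \sum_(i < k) a i * b i.

Definition ideal_pow I (m : nat) : {mpoly K[n.+1]} -> Prop :=
  ideal_gen (fun f => exists g : 'I_m -> {mpoly K[n.+1]},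
    (forall i, I (g i)) /\ f = \prod_(i < m) g i).

(* [dhomog n.+1 K t] is the vector space R_t of forms of degree t (0 included);
   the relation says that R_t / (I :&: R_t) is isomorphic to K^d. *)
Definition graded_quotient_dim I (t d : nat) : Prop :=
  exists phi : 'Hom(dhomog n.+1 K t, 'rV[K]_d),
    limg phi = fullv /\
    (forall f : dhomog n.+1 K t, f \in lker phi <-> I (val f)).

End Ideals.

(* A point of P^n is given by a nonzero vector of homogeneous coordinates, i.e.
   by the line it spans in K^(n+1); two vectors u, v define the same point
   iff their row spaces agree, (u == v)%MS. *)

Section FatPoints.
Variables (K : fieldType) (n s : nat).
Implicit Types (P : 'I_s -> 'rV[K]_n.+1) (m : 'I_s -> nat).

Definition distinct_points P : Prop :=
  (forall i, P i != 0) /\ (forall i j, (P i == P j)%MS -> i = j).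

Definition nondegenerate_points P : Prop := row_full (\matrix_(i < s) P i).

Definition point_ideal (v : 'rV[K]_n.+1) : {mpoly K[n.+1]} -> Prop :=
  ideal_gen (fun f => (exists d : nat, f \is d.-homog) /\
                      f.@[fun k => v 0 k] = 0).

Definition fat_ideal P m (f : {mpoly K[n.+1]}) : Prop :=
  forall i, ideal_pow (point_ideal (P i)) (m i) f.

Definition multiplicity m : nat := (\sum_(i < s) 'C(m i + n - 1, n))%N.

(* Negative degrees are irrelevant: there (R/I)_t = 0, whereas the
   multiplicity is positive as soon as 0 < s and all m i are positive. *)
Definition is_regularity_index P m (t : nat) : Prop :=
  graded_quotient_dim (fat_ideal P m) t (multiplicity m) /\
  (forall t' : nat,
     graded_quotient_dim (fat_ideal P m) t' (multiplicity m) -> (t <= t')%N).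

(* A j-dimensional linear subspace of P^n is a (j+1)-dimensional subspace
   of K^(n+1), here the row space of W. *)
Definition on_linear_subspace P (A : {set 'I_s}) (j : nat) : Prop :=
  exists W : 'M[K]_n.+1,
    \rank W = j.+1 /\ (forall i, i \in A -> (P i <= W)%MS).

(* The truncated subtraction only matters for the empty set A and j = 1, where
   it contributes 0; for j, m, #|A| > 0 one has 2 <= m * #|A| + j. *)
Definition T_ P (m : nat) (j : nat) : nat :=
  (\max_(A : {set 'I_s} | `[< on_linear_subspace P A j >])
     ((m * #|A| + j - 2) %/ j))%N.

Definition T_max P (m : nat) : nat := (\max_(1 <= j < n.+1) T_ P m j)%N.

End FatPoints.

(* Main.v *)
Require Import Defs.
From HB Require Import structures.
From mathcomp Require Import all_boot all_order all_algebra.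
From mathcomp Require Import boolp mpoly.
From mathcomp Require Import zify.

(* Write p_i for the ideal of P_i and j = rank A - 1 for the dimension of the
   span of a set A of points.  Since R/I embeds into the direct sum of the
   R/p_i^m, the Hilbert function of Z reaches the multiplicity in degree t
   exactly when m <= t + 1 and the forms of degree t separate the jets of order
   m at the points.

   Upper bound.  Fix a point v.  A form of degree t that vanishes to order m at
   the other points and has a prescribed leading form, a product of k < m linear
   forms, at v is built one linear factor at a time.  Giving each other point x
   the weight u_x = t - m, Segre's inequalities m |A| <= j t + 1 become
   u(A) >= null(A) t + k, where null is the nullity in the matroid of the points
   projected from v.  This matroid has corank at most 2 because s <= n + 3, and
   then the series classes of largest weight provide a basis of points whose
   removal, by a hyperplane, preserves these inequalities for t - 1.

   Lower bound.  A rational normal curve of degree j through the points of A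
   turns a form separating the jets in degree t into a nonzero polynomial of
   degree at most j t with m |A| - 1 roots.  Nondegeneracy gives |A| <= j + 3,
   so such a curve exists as soon as A is in linearly general position in its
   span, and otherwise a subset of A spanning a smaller subspace gives the bound.
   The only exception is m = 2 with seven points in P^4 of which five lie in a
   hyperplane, where an explicit cubic is singular at all seven points. *)


Set Implicit Arguments.
Unset Strict Implicit.
Unset Printing Implicit Defensive.

(** * Removing a basis from a matroid of corank at most two *)

Lemma sum_subset_le (E : finType) (u : E -> nat) (A B : {set E}) : A \subset B ->
  \sum_(x in A) u x <= \sum_(x in B) u x.
Proof. by move=> AB; rewrite [leqRHS](big_setID A) /= (setIidPr AB) leq_addr. Qed.

Lemma sum_disjoint_le (E : finType) (u : E -> nat) (A B D : {set E}) :
  A \subset D -> B \subset D -> [disjoint A & B] ->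
  \sum_(x in A) u x + \sum_(x in B) u x <= \sum_(x in D) u x.
Proof.
move=> AD BD AB; rewrite [leqRHS](big_setID A) /= (setIidPr AD) leq_add2l.
by apply: sum_subset_le; rewrite subsetD BD disjoint_sym.
Qed.

Section Nullity.
Variables (E : finType) (nu : {set E} -> nat).
Hypothesis nu_supermod : forall A B : {set E}, nu A + nu B <= nu (A :|: B) + nu (A :&: B).
Hypothesis nuS : forall A B : {set E}, A \subset B -> nu A <= nu B.
Hypothesis nu_setD1 : forall (A : {set E}) x, nu A <= nu (A :\ x) + 1.
Variables (u : E -> nat) (t k : nat).
Hypothesis k_lt : k < t.
Hypothesis nu_le : forall A : {set E}, A != set0 -> nu A * t + k <= \sum_(x in A) u x.
Hypothesis nu0 : nu set0 = 0.
Implicit Types (A B N : {set E}) (x y z : E).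

Lemma nu_neq0 A : 0 < nu A -> A != set0.
Proof. by apply: contraTneq => ->; rewrite nu0. Qed.

Lemma nu_gt0_le A : 0 < nu A -> nu A * t + k <= \sum_(x in A) u x.
Proof. by move/nu_neq0/nu_le. Qed.

Lemma sum_gt0 A : 0 < nu A -> exists2 x, x \in A & 0 < u x.
Proof.
move=> A0; apply/exists_inP; apply: contraLR (nu_le (nu_neq0 A0)).
rewrite negb_exists_in => /forall_inP uA.
rewrite big1 => [|x /uA]; [nia | by rewrite lt0n negbK => /eqP].
Qed.

(** Supermodularity for [~: B] and [N], whose union is everything. It makes [~: O] independent as
    soon as [N :\: O] is. *)
Lemma nu_setC_le A B N : B \subset N -> nu N = nu setT -> nu (~: B) <= nu (N :\: B).
Proof.
move=> BN nuN; have := nu_supermod (~: B) N.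
have -> : ~: B :|: N = setT.
  by apply/setP=> x; rewrite !inE; case: (boolP (x \in B)) => //= /(subsetP BN).
have -> : ~: B :&: N = N :\: B by rewrite setIC -setDE.
by rewrite nuN addnC leq_add2l.
Qed.

(** The matroid restricted to such an [N] has no coloops: every element lies on a circuit. *)
Definition minimal N := forall x, x \in N -> nu (N :\ x) < nu N.

Lemma minimal_exists : exists2 N, minimal N & nu N = nu setT.
Proof.
pose p (A : {set E}) := nu A == nu setT.
have [|N /minsetP[/eqP nuN minN] _] := @minset_exists E p setT; first exact: eqxx.
exists N => // x xN; rewrite ltn_neqAle nuS ?subD1set // andbT.
apply/negP => /eqP nuNx; have := minN (N :\ x).
rewrite /p nuNx nuN eqxx subD1set => /(_ isT isT) NE.
by move: xN; rewrite -NE !inE eqxx.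
Qed.

(* The classes are the series classes of the matroid restricted to [N], so
   [N :\: cls N x] is the circuit avoiding [x]. *)
Definition series N x y := 0 < nu (N :\ x :\ y).
Definition cls N x := [set y in N | series N x y].

Section Corank2.
Variable N : {set E}.
Hypotheses (minN : minimal N) (nuN : nu N = 2).

Lemma nu_minD1 x : x \in N -> nu (N :\ x) = 1.
Proof. by move=> xN; have := minN xN; have := nu_setD1 N x; lia. Qed.

Lemma series_sym x y : series N x y = series N y x.
Proof. by rewrite /series setDDl setDDl setUC. Qed.

Lemma series_refl x : x \in N -> series N x x.
Proof.
move=> xN; rewrite /series (_ : N :\ x :\ x = N :\ x) ?nu_minD1 //.
by rewrite setDDl setUid.
Qed.

(** [N :\ x :\ y] and [N :\ y :\ z] both lie in [N :\ y], which has nullity one, so by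
    supermodularity their intersection is still dependent. *)
Lemma series_trans x y z : y \in N -> series N x y -> series N y z -> series N x z.
Proof.
rewrite /series => yN xy yz.
have := nu_supermod (N :\ x :\ y) (N :\ y :\ z).
have : nu ((N :\ x :\ y) :|: (N :\ y :\ z)) <= 1.
  rewrite -(nu_minD1 yN); apply/nuS/subsetP => w; rewrite !inE.
  by case/orP=> /and3P[? ? ?]; apply/andP.
have : nu ((N :\ x :\ y) :&: (N :\ y :\ z)) <= nu (N :\ x :\ z).
  by apply/nuS/subsetP => w; rewrite !inE => /andP[/and3P[_ -> ->] /and3P[->]].
move: xy yz; lia.
Qed.

Lemma nu_setD_cls x : x \in N -> nu (N :\: cls N x) = 1.
Proof.
move=> xN; apply/eqP; rewrite eqn_leq; apply/andP; split.
  rewrite -(nu_minD1 xN); apply/nuS/setDS; rewrite sub1set !inE xN.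
  exact: series_refl.
(* The members of the class are deleted one at a time; supermodularity inside [N :\ x], of nullity
   one, keeps the remainder dependent. *)
suff H (r : seq E) : {subset r <= cls N x} -> 0 < nu (N :\ x :\: [set y in r]).
  apply: leq_trans (H (enum (cls N x)) _) _ => [y|]; first by rewrite mem_enum.
  by apply/nuS; rewrite set_enum setSD // subD1set.
elim: r => [_|y r IHr sr].
  by rewrite (_ : [set y in [::]] = set0) ?setD0 ?nu_minD1 //; apply/setP=> w; rewrite !inE.
have ysr : y \in cls N x by apply: sr; rewrite mem_head.
have {}IHr : 0 < nu (N :\ x :\: [set y in r]).
  by apply: IHr => z zr; apply: sr; rewrite inE zr orbT.
have xy : 0 < nu (N :\ x :\ y) by move: ysr; rewrite inE => /andP[].
have := nu_supermod (N :\ x :\: [set y in r]) (N :\ x :\ y).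
have : nu ((N :\ x :\: [set y in r]) :|: (N :\ x :\ y)) <= 1.
  by rewrite -(nu_minD1 xN); apply/nuS; rewrite subUset !subsetDl.
have : nu ((N :\ x :\: [set y in r]) :&: (N :\ x :\ y)) <=
       nu (N :\ x :\: [set z in y :: r]).
  by apply/nuS/subsetP => w; rewrite !inE negb_or => /andP[/andP[-> _] /andP[-> ->]].
lia.
Qed.

Lemma cls_eq x y : x \in N -> y \in N -> series N x y -> cls N x = cls N y.
Proof.
move=> xN yN xy; apply/setP=> z; rewrite !inE; case: (boolP (z \in N)) => //= zN.
apply/idP/idP; first by apply: series_trans => //; rewrite series_sym.
exact: series_trans.
Qed.

Definition wt x := \sum_(y in cls N x) u y.

Lemma wt_setD x : x \in N -> wt x + \sum_(y in N :\: cls N x) u y = \sum_(y in N) u y.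
Proof.
move=> xN; rewrite [RHS](big_setID (cls N x)) /=; congr (_ + _).
by apply: eq_bigl => y; rewrite !inE; case: (y \in N).
Qed.

(** The heaviest class has positive weight because [B] has an element of positive weight; the
    representative is then moved within its class to an element with [0 < u], whose weight can be
    lowered by one. *)
Lemma heavy_exists (B : {set E}) : B \subset N -> 0 < nu B ->
  (forall x y, x \in B -> y \in N -> series N x y -> y \in B) ->
  exists2 x, x \in B & 0 < u x /\ forall z, z \in B -> wt z <= wt x.
Proof.
move=> BN nuB clB; have [x0 x0B ux0] := sum_gt0 nuB.
case: (arg_maxnP wt x0B) => x xB xmax.
have x0N := subsetP BN _ x0B; have xN := subsetP BN _ xB.
have : 0 < wt x.
  apply: leq_trans (xmax _ x0B); rewrite /wt (bigD1 x0) ?addn_gt0 ?ux0 //.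
  by rewrite inE x0N series_refl.
rewrite lt0n sum_nat_eq0 negb_forall_in => /exists_inP[y].
rewrite inE => /andP[yN xy]; rewrite -lt0n => uy.
exists y; first exact: clB xB yN xy.
by split=> // z zB; rewrite /wt -(cls_eq xN yN xy); apply: xmax.
Qed.

End Corank2.

(* Deleting the basis [~: O] from the multiset in which [x] has multiplicity
   [t - u x] preserves [nu_le] for [t - 1]. *)
Lemma removable_exists : nu setT <= 2 -> exists O : {set E},
  [/\ nu (~: O) = 0, forall x, x \in O -> 0 < u x &
      forall A, 0 < nu A -> nu A * t + k + #|A :&: O| <= \sum_(x in A) u x + nu A].
Proof.
have [N minN nuN] := minimal_exists; rewrite -nuN => N2.
have nuA_le A : nu A <= nu N by rewrite nuN; apply/nuS/subsetT.
(* A set whose nullity is at least [#|O|] absorbs the loss. *)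
have slack A (O : {set E}) : #|O| <= nu A -> 0 < nu A ->
    nu A * t + k + #|A :&: O| <= \sum_(x in A) u x + nu A.
  move=> OA A0; apply: leq_add; first exact/nu_le/nu_neq0.
  exact: leq_trans (subset_leq_card (subsetIr _ _)) OA.
case nuNE : (nu N) N2 => [|[|[|//]]] _.
- exists set0; split=> [|x|A nuA]; rewrite ?inE ?setC0 -?nuN //.
  by have := nuA_le A; lia.
- have [x xN ux] : exists2 x, x \in N & 0 < u x by apply: sum_gt0; rewrite nuNE.
  exists [set x]; split=> [|y /set1P-> //|A nuA]; last by apply: slack; rewrite ?cards1.
  have := @nu_setC_le set0 [set x] N; rewrite sub1set xN nuN => /(_ isT erefl).
  by have := minN x xN; rewrite nuNE; lia.
(* In corank two, [O] consists of [x] from a heaviest series class and [y] from a heaviest class of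
   the circuit [N :\: cls N x]. *)
have [||x xN [ux xmax]] := heavy_exists minN nuNE (subxx N); rewrite ?nuNE //.
have nuD := nu_setD_cls minN nuNE xN.
have [||y] := heavy_exists minN nuNE (subsetDl N (cls N x)); rewrite ?nuD //.
  move=> y z; rewrite !inE => /andP[xy yN] zN yz; rewrite zN andbT; apply: contra xy.
  rewrite yN => xz; apply: (series_trans minN nuNE zN xz).
  by rewrite series_sym.
rewrite !inE => /andP[xy yN] [uy ymax]; rewrite yN /= in xy.
have xy_neq : x != y by apply: contraNneq xy => <-; exact: series_refl.
exists [set x; y]; split.
- have := @nu_setC_le set0 [set x; y] N; rewrite subUset !sub1set xN yN nuN => /(_ isT erefl).
  by move: xy; rewrite /series -setDDl -leqNgt; lia.
- by move=> z /set2P[] ->.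
move=> A nuA; have [nuA2|nuA2] := leqP 2 (nu A).
  by apply: slack => //; rewrite cards2 xy_neq.
have {nuA nuA2} nuA : nu A = 1 by lia.
have [xyA|xyA] := boolP ([set x; y] \subset A); last first.
  rewrite nuA mul1n; apply: leq_add.
    by have := @nu_gt0_le A; rewrite nuA mul1n; apply.
  have : A :&: [set x; y] \proper [set x; y].
    by rewrite properE subsetIr subsetI (negbTE xyA).
  by move/proper_card; rewrite cards2 xy_neq.
(* The critical case: [A] has nullity one and contains both [x] and [y], so its weight must exceed
   [t + k]. *)
have xA : x \in A by apply: (subsetP xyA); rewrite !inE eqxx.
have yA : y \in A by apply: (subsetP xyA); rewrite !inE eqxx orbT.
have [z zN zA] : exists2 z, z \in N & z \notin A.
  by apply/subsetPn/negP => /nuS; rewrite nuNE nuA.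
have nuAN : 0 < nu (A :&: N).
  rewrite -(leq_add2l (nu (A :|: N))); apply: leq_trans (nu_supermod A N).
  by rewrite nuNE nuA addn1 ltnS -nuNE nuA_le.
(* If [w] in [N] is missing from [A], then [N :\ z :\ w] contains the dependent set [A :&: N], so
   [w] is in series with [z]. Hence [A] contains the circuit avoiding [z]. *)
have DA : N :\: cls N z \subset A.
  apply/subsetP=> w; rewrite !inE => /andP[zw wN]; rewrite wN /= in zw.
  apply: contraNT zw => wA; apply: leq_trans nuAN _; apply/nuS/subsetP=> a.
  rewrite !inE => /andP[aA ->]; rewrite andbT.
  by apply/andP; split; [apply: contraNneq wA | apply: contraNneq zA] => <-.
have wtz := wt_setD zN.
have uN : 2 * t + k <= \sum_(w in N) u w by have := @nu_gt0_le N; rewrite nuNE; apply.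
have uD : t + k <= \sum_(w in N :\: cls N z) u w.
  have := @nu_gt0_le (N :\: cls N z).
  by rewrite (nu_setD_cls minN nuNE zN) mul1n; apply.
have uA_gt w : w \in A -> 0 < u w -> w \in cls N z ->
    \sum_(w in N :\: cls N z) u w < \sum_(w in A) u w.
  move=> wA uw wz; have wD : [disjoint [set w] & N :\: cls N z].
    by rewrite disjoints1 inE wz.
  have := sum_disjoint_le u _ DA wD; rewrite sub1set big_set1 => /(_ wA).
  by apply: leq_trans; rewrite -[X in X < _]add0n ltn_add2r.
have wA2 : A :&: [set x; y] = [set x; y] by apply/setIidPr.
rewrite wA2 cards2 xy_neq nuA mul1n addn1 addn2 ltnS.
(* If [x] or [y] is off that circuit, its positive weight gives the extra unit. *)
have [xz|xz] := boolP (x \in cls N z); first exact: leq_ltn_trans uD (uA_gt _ xA ux xz).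
have [yz|yz] := boolP (y \in cls N z); first exact: leq_ltn_trans uD (uA_gt _ yA uy yz).
have zx : z \in N :\: cls N x.
  by rewrite !inE zN andbT /= series_sym; move: xz; rewrite inE xN.
have sub_cls w : w \in N -> w \notin cls N z -> cls N w \subset N :\: cls N z.
  move=> wN wz; apply/subsetP=> a; rewrite !inE => /andP[aN wa]; rewrite aN andbT.
  apply: contra wz => za; rewrite inE wN; apply: (series_trans minN nuNE aN za).
  by rewrite series_sym.
have disj : [disjoint cls N x & cls N y].
  rewrite -setI_eq0; apply/eqP/setP=> a; rewrite !inE.
  apply/negP => /andP[/andP[aN xa] /andP[_ ya]]; case/negP: xy.
  by apply: (series_trans minN nuNE aN xa); rewrite series_sym.
have le_xy := sum_disjoint_le u (sub_cls _ xN xz) (sub_cls _ yN yz) disj.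
(* Otherwise the circuit contains the classes of [x] and [y], each at least as heavy as that of [z],
   so it carries at least two thirds of the weight of [N]; two thirds of [2 * t + k] exceeds [t + k]
   because [k < t]. *)
have arith a b c d e f : 2 * t + k <= d -> c + e = d -> c <= a -> c <= b ->
  a + b <= e -> e <= f -> t + k < f by clear -k_lt; lia.
exact: arith uN wtz (xmax _ zN) (ymax _ zx) le_xy (sum_subset_le u DA).
Qed.

End Nullity.

Import GRing.Theory.
Local Open Scope ring_scope.

(** * Ideals, linear forms and linear substitutions *)

Section IdealGen.
Variables (K : fieldType) (n : nat).
Notation R := {mpoly K[n.+1]}.
Implicit Types (S I : R -> Prop) (f g : R).

Lemma ideal_gen0 S : ideal_gen S 0.
Proof. by exists 0%N, (fun=> 0), (fun=> 0); split; [case | rewrite big_ord0]. Qed.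

Lemma ideal_genD S f g : ideal_gen S f -> ideal_gen S g -> ideal_gen S (f + g).
Proof.
move=> [k [a [b [Sb ->]]]] [l [c [d [Sd ->]]]].
pose cat2 (x : 'I_k -> R) (y : 'I_l -> R) (i : 'I_(k + l)) :=
  match split i with inl i => x i | inr i => y i end.
exists (k + l)%N, (cat2 a c), (cat2 b d); split.
  by move=> i; rewrite /cat2; case: (split i).
rewrite big_split_ord /cat2; congr (_ + _); apply: eq_bigr => i _.
  by rewrite (unsplitK (inl i)).
by rewrite (unsplitK (inr i)).
Qed.

Lemma ideal_genMl S f g : ideal_gen S g -> ideal_gen S (f * g).
Proof.
move=> [k [a [b [Sb ->]]]]; exists k, (fun i => f * a i), b; split=> //.
by rewrite mulr_sumr; apply: eq_bigr => i _; rewrite mulrA.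
Qed.

Lemma ideal_genMr S f g : ideal_gen S f -> ideal_gen S (f * g).
Proof. by rewrite mulrC; apply: ideal_genMl. Qed.

Lemma ideal_gen_mem S f : S f -> ideal_gen S f.
Proof.
move=> Sf; exists 1%N, (fun=> 1), (fun=> f); split=> //.
by rewrite big_ord1 mul1r.
Qed.

Lemma ideal_gen_sum S (J : Type) (r : seq J) (p : pred J) (F : J -> R) :
  (forall j, p j -> ideal_gen S (F j)) -> ideal_gen S (\sum_(j <- r | p j) F j).
Proof.
by move=> SF; apply: big_ind => //; [exact: ideal_gen0 | exact: ideal_genD].
Qed.

Lemma ideal_genZ S c f : ideal_gen S f -> ideal_gen S (c *: f).
Proof. by rewrite -mul_mpolyC; apply: ideal_genMl. Qed.

Lemma ideal_gen_min S (Q : R -> Prop) :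
  Q 0 -> (forall f g, Q f -> Q g -> Q (f + g)) ->
  (forall f g, Q g -> Q (f * g)) -> (forall f, S f -> Q f) ->
  forall f, ideal_gen S f -> Q f.
Proof.
move=> Q0 QD QM QS f [k [a [b [Sb ->]]]].
by apply: big_ind => // i _; apply/QM/QS.
Qed.

Lemma ideal_pow0 I f : ideal_pow I 0 f.
Proof.
rewrite -[f]mulr1; apply/ideal_genMl/ideal_gen_mem.
by exists (fun=> 0); split; [case | rewrite big_ord0].
Qed.

Lemma ideal_powD I k l f g :
  ideal_pow I k f -> ideal_pow I l g -> ideal_pow I (k + l) (f * g).
Proof.
move=> [p [a [b [Ib ->]]]] [q [c [d [Id ->]]]].
rewrite mulr_suml; apply: ideal_gen_sum => i _.
rewrite -mulrA mulr_sumr; apply/ideal_genMl/ideal_gen_sum => j _.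
rewrite mulrCA; apply/ideal_genMl/ideal_gen_mem.
have [x [Ix ->]] := Ib i; have [y [Iy ->]] := Id j.
pose cat2 (i : 'I_(k + l)) :=
  match split i with inl i => x i | inr i => y i end.
exists cat2; split; first by move=> h; rewrite /cat2; case: (split h).
rewrite big_split_ord /cat2; congr (_ * _); apply: eq_bigr => h _.
  by rewrite (unsplitK (inl h)).
by rewrite (unsplitK (inr h)).
Qed.

Lemma ideal_pow1 I f : I f -> ideal_pow I 1 f.
Proof.
move=> If; apply: ideal_gen_mem; exists (fun=> f); split=> //.
by rewrite big_ord1.
Qed.

Lemma ideal_powX I f k : I f -> ideal_pow I k (f ^+ k).
Proof.
move=> If; elim: k => [|k IHk]; first exact: ideal_pow0.
by rewrite exprS -add1n; apply: ideal_powD => //; exact: ideal_pow1.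
Qed.

Lemma ideal_pow_le I k l f : (k <= l)%N -> ideal_pow I l f -> ideal_pow I k f.
Proof.
move=> /subnKC <-; apply: ideal_gen_min; first exact: ideal_gen0.
- by move=> ? ?; apply: ideal_genD.
- by move=> ? ?; apply: ideal_genMl.
move=> _ [g [Ig ->]]; rewrite big_split_ord /=; apply/ideal_genMr/ideal_gen_mem.
by exists (fun i => g (lshift _ i)).
Qed.

End IdealGen.

Section LinearSubstitution.
Variable K : fieldType.

Definition lform n (c : 'cV[K]_n) : {mpoly K[n]} := \sum_(i < n) c i 0 *: 'X_i.

(** Pullback of polynomials along the linear map [v |-> v *m M]. *)
Definition lsub a b (M : 'M[K]_(a, b)) (p : {mpoly K[b]}) : {mpoly K[a]} :=
  p \mPo [tuple lform (col j M) | j < b].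

HB.instance Definition _ a b (M : 'M[K]_(a, b)) :=
  GRing.RMorphism.copy (lsub M) (comp_mpoly [tuple lform (col j M) | j < b]).
HB.instance Definition _ a b (M : 'M[K]_(a, b)) :=
  GRing.Linear.copy (lsub M) (comp_mpoly [tuple lform (col j M) | j < b]).

Lemma lform_homog n (c : 'cV[K]_n) : lform c \is 1.-homog.
Proof.
rewrite /lform; apply: rpred_sum => i _; apply: rpredZ.
by rewrite dhomogX; apply/eqP; exact: mdeg1.
Qed.

Lemma lform_eval n (c : 'cV[K]_n) (v : 'rV_n) :
  (lform c).@[fun i => v 0 i] = (v *m c) 0 0.
Proof.
rewrite /lform raddf_sum /= !mxE; apply: eq_bigr => i _.
by rewrite mevalZ mevalXU mulrC.
Qed.

Lemma lformD n (c d : 'cV[K]_n) : lform (c + d) = lform c + lform d.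
Proof.
by rewrite /lform -big_split; apply: eq_bigr => i _; rewrite mxE scalerDl.
Qed.

Lemma lformZ n a (c : 'cV[K]_n) : lform (a *: c) = a *: lform c.
Proof.
by rewrite /lform scaler_sumr; apply: eq_bigr => i _; rewrite mxE scalerA.
Qed.

Lemma lform0 n : lform (0 : 'cV[K]_n) = 0.
Proof. by rewrite /lform big1 // => i _; rewrite mxE scale0r. Qed.

Lemma lform_sum n (J : Type) (r : seq J) (p : pred J) (F : J -> 'cV[K]_n) :
  lform (\sum_(j <- r | p j) F j) = \sum_(j <- r | p j) lform (F j).
Proof. by apply: (big_morph (@lform n)); [exact: lformD | exact: lform0]. Qed.

Lemma lsubX a b (M : 'M[K]_(a, b)) j : lsub M 'X_j = lform (col j M).
Proof. by rewrite /lsub comp_mpolyXU -tnth_nth tnth_mktuple. Qed.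

Lemma lsub_lform a b (M : 'M[K]_(a, b)) c : lsub M (lform c) = lform (M *m c).
Proof.
rewrite {1}/lform linear_sum /=.
have -> : M *m c = \sum_j c j 0 *: col j M.
  apply/matrixP=> i k; rewrite summxE !mxE ord1; apply: eq_bigr => j _.
  by rewrite !mxE mulrC.
by rewrite lform_sum; apply: eq_bigr => j _; rewrite linearZ /= lsubX lformZ.
Qed.

Lemma lsub_XM a b (M : 'M[K]_(a, b)) m :
  lsub M 'X_[m] = \prod_j lform (col j M) ^+ m j.
Proof.
rewrite /lsub comp_mpolyX; apply: eq_bigr => j _.
by rewrite tnth_mktuple.
Qed.

Lemma lsub_comp a b c (M : 'M[K]_(a, b)) (N : 'M[K]_(b, c)) p :
  lsub M (lsub N p) = lsub (M *m N) p.
Proof.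
rewrite [p]mpolyE (linear_sum (lsub N)) (linear_sum (lsub M)).
rewrite (linear_sum (lsub (M *m N))) /=; apply: eq_bigr => m _.
rewrite !linearZ /=; congr (_ *: _); rewrite !lsub_XM rmorph_prod /=.
by apply: eq_bigr => j _; rewrite rmorphXn /= lsub_lform colE mulmxA -colE.
Qed.

Lemma lsub1 a p : lsub (1%:M : 'M[K]_a) p = p.
Proof.
rewrite -[RHS]comp_mpoly_id /lsub; congr (_ \mPo _).
apply: eq_from_tnth => j; rewrite !tnth_mktuple /lform (bigD1 j) //= !mxE eqxx.
rewrite scale1r big1 ?addr0 // => i /negbTE ij; rewrite !mxE ij scale0r //.
Qed.

Lemma lsub_eval a b (M : 'M[K]_(a, b)) p (v : 'rV_a) :
  (lsub M p).@[fun i => v 0 i] = p.@[fun i => (v *m M) 0 i].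
Proof.
rewrite /lsub comp_mpoly_meval; apply: meval_eq => j.
by rewrite tnth_mktuple lform_eval colE mulmxA -colE mxE.
Qed.

Lemma dhomog_prod_seq n (J : Type) (r : seq J) (F : J -> {mpoly K[n]}) (d : J -> nat) :
  (forall j, F j \is (d j).-homog) ->
  \prod_(j <- r) F j \is (\sum_(j <- r) d j).-homog.
Proof.
move=> homF; elim: r => [|j r IHr]; first by rewrite !big_nil dhomog1.
by rewrite !big_cons; apply: dhomogM.
Qed.

Lemma lsub_homog a b (M : 'M[K]_(a, b)) d p :
  p \is d.-homog -> lsub M p \is d.-homog.
Proof.
move=> /dhomogP homp; rewrite [p]mpolyE (linear_sum (lsub M)) big_seq /=.
apply: rpred_sum => m /homp <-; rewrite [lsub M _]linearZ /=; apply: rpredZ.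
rewrite lsub_XM mdegE; apply: dhomog_prod_seq => j.
by have := dhomogMn (m j) (lform_homog (col j M)); rewrite mul1n.
Qed.

End LinearSubstitution.

(** * Order of vanishing in coordinates *)

Section ProjectiveFrame.
Variables (K : fieldType) (n : nat).
Notation R := {mpoly K[n.+1]}.
Implicit Types (f h p q : R) (v : 'rV[K]_n.+1) (g : 'M[K]_n.+1) (a : 'X_{1..n.+1}).

Definition edeg a := (mdeg a - a ord0)%N.

Lemma edegE a : edeg a = (\sum_(i < n) a (lift ord0 i))%N.
Proof. by rewrite /edeg mdegE big_ord_recl addKn. Qed.

Lemma edegD a b : edeg (a + b)%MM = (edeg a + edeg b)%N.
Proof.
by rewrite !edegE -big_split; apply: eq_bigr => i _; rewrite mnmDE.
Qed.

Lemma mdeg_edeg a : mdeg a = (a ord0 + edeg a)%N.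
Proof. by rewrite edegE mdegE big_ord_recl. Qed.

(* Dehomogenized by [X_0 = 1], [p] vanishes to order [k] at the origin. *)
Definition vord k p := forall a, (edeg a < k)%N -> p@_a = 0.

Lemma vord0 p : vord 0 p. Proof. by []. Qed.

Lemma vordD k p q : vord k p -> vord k q -> vord k (p + q).
Proof. by move=> vp vq a ak; rewrite mcoeffD vp // vq // addr0. Qed.

Lemma vordM k l p q : vord k p -> vord l q -> vord (k + l) (p * q).
Proof.
move=> vp vq a akl; rewrite mcoeffM big1 // => -[b c] /= /eqP abc.
have [bk|kb] := ltnP (edeg b) k; first by rewrite vp ?mul0r.
have {akl} : (edeg b + edeg c < k + l)%N by rewrite -edegD -abc.
by move=> akl; rewrite [q@__]vq ?mulr0 //; lia.
Qed.

Lemma vord_prod k (F : 'I_k -> R) :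
  (forall i, vord 1 (F i)) -> vord k (\prod_(i < k) F i).
Proof.
elim: k F => [|k IHk] F vF; first exact: vord0.
by rewrite big_ord_recl; apply: (@vordM 1 k) => //; apply: IHk.
Qed.

Lemma edeg0_eq a : edeg a = 0%N -> a = (U_(ord0) *+ mdeg a)%MM.
Proof.
move=> a0; apply/mnmP => i; rewrite mulmnE mnm1E mdeg_edeg a0 addn0.
have [->|i0] := eqVneq i ord0; first by rewrite mul1n.
rewrite mul0n.
move: a0; rewrite edegE; case: (unliftP ord0 i) i0 => [j -> _|-> /eqP//].
by move/eqP; rewrite sum_nat_eq0 => /forallP/(_ j)/eqP.
Qed.

Lemma meval_frame d p : p \is d.-homog ->
  p.@[fun i => (delta_mx 0 ord0 : 'rV_n.+1) 0 i] = p@_(U_(ord0) *+ d).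
Proof.
move=> /dhomogP homp; rewrite [in RHS](mpolyE p) raddf_sum /= mevalE.
apply: eq_big_seq => a /homp da; rewrite mcoeffZ mcoeffX; congr (_ * _).
rewrite (bigD1 ord0) //= mxE !eqxx expr1n mul1r.
have [->|ad] := eqVneq a.
  rewrite big1 // => i i0; rewrite mulmnE mnm1E eq_sym (negbTE i0) mul0n.
  by rewrite expr0.
have [a0|] := eqVneq (edeg a) 0%N; first by rewrite -da -edeg0_eq // eqxx in ad.
rewrite edegE sum_nat_eq0 => /forallPn[i /= ai].
rewrite (bigD1 (lift ord0 i)) //= mxE eqxx [lift _ _ == _]eq_sym.
by rewrite (negbTE (neq_lift _ _)) expr0n (negbTE ai) mul0r.
Qed.

Lemma vord1_frame d p : p \is d.-homog ->
  p.@[fun i => (delta_mx 0 ord0 : 'rV_n.+1) 0 i] = 0 -> vord 1 p.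
Proof.
move=> homp; rewrite (meval_frame homp) => pd a.
rewrite ltnS leqn0 => /eqP/edeg0_eq aE; apply/eqP; rewrite mcoeff_eq0.
apply/negP => asupp; move/eqP: pd; rewrite mcoeff_eq0; apply/negP/negPn.
by move/dhomogP: homp => /(_ _ asupp) <-; rewrite -aE.
Qed.

(** In the coordinates given by [g] the point becomes the first coordinate point, so that powers of
    its ideal can be studied on monomials. *)
Lemma frame_exists v : v != 0 -> exists2 g, g \in unitmx & row ord0 g = v.
Proof.
move=> v0; pose e : 'rV[K]_n.+1 := delta_mx 0 ord0.
pose f : 'M[K]_n.+1 := delta_mx ord0 0 *m v.
have ef : e *m f = v.
  rewrite mulmxA mul_delta_mx; apply/rowP=> j.
  by rewrite !mxE big_ord1 !mxE eqxx mul1r.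
have [|g gU] := @complete_unitmx _ 1 n.+1 e f.
  by rewrite ef rank_rV v0 mxrank_delta.
by rewrite ef -rowE => vE; exists g.
Qed.

Lemma point_ideal_lform v c : v *m c = 0 -> point_ideal v (lform c).
Proof.
move=> vc; apply: ideal_gen_mem; split; first by exists 1%N; exact: lform_homog.
by rewrite lform_eval vc mxE.
Qed.

Lemma lsub_frame_eval g p :
  (lsub g p).@[fun i => (delta_mx 0 ord0 : 'rV_n.+1) 0 i] =
  p.@[fun i => (row ord0 g) 0 i].
Proof. by rewrite lsub_eval -rowE. Qed.

Lemma frame_dual g j : g \in unitmx -> j != ord0 -> row ord0 g *m col j (invmx g) = 0.
Proof.
move=> gU j0; rewrite rowE colE mulmxA -(mulmxA _ g) mulmxV // mulmx1.
by rewrite mul_delta_mx_0 // eq_sym.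
Qed.

Lemma frame_dual0 g : g \in unitmx -> row ord0 g *m col ord0 (invmx g) = 1.
Proof.
move=> gU; rewrite rowE colE mulmxA -(mulmxA _ g) mulmxV // mulmx1.
by rewrite mul_delta_mx; apply/matrixP=> i k; rewrite !ord1 !mxE.
Qed.

(** The monomial [a] in frame coordinates, without its power of [X_0], as a list of linear forms
    vanishing at the point. *)
Definition frame_seq g a : seq 'cV[K]_n.+1 :=
  flatten [seq nseq (a (lift ord0 i)) (col (lift ord0 i) (invmx g)) | i <- enum 'I_n].

Lemma size_frame_seq g a : size (frame_seq g a) = edeg a.
Proof.
rewrite /frame_seq size_flatten /shape -map_comp edegE sumnE big_map big_enum /=.
by apply: eq_bigr => i _; rewrite size_nseq.
Qed.

Lemma frame_seq_dual g a : g \in unitmx ->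
  forall c, c \in frame_seq g a -> row ord0 g *m c = 0.
Proof.
move=> gU c /flatten_mapP[i _ /nseqP[-> _]]; apply: frame_dual => //.
Qed.

Lemma lsub_frame_seq g a :
  lsub (invmx g) 'X_[a] =
  lform (col ord0 (invmx g)) ^+ a ord0 * \prod_(c <- frame_seq g a) lform c.
Proof.
rewrite lsub_XM big_ord_recl; congr (_ * _).
rewrite /frame_seq big_flatten big_map big_enum /=; apply: eq_bigr => i _.
by rewrite big_nseq -Monoid.iteropE.
Qed.

Lemma ideal_pow_lforms v (r : seq 'cV[K]_n.+1) : (forall c, c \in r -> v *m c = 0) ->
  ideal_pow (point_ideal v) (size r) (\prod_(c <- r) lform c).
Proof.
elim: r => [|c r IHr] vr; first exact: ideal_pow0.
rewrite big_cons /= -add1n; apply: ideal_powD.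
  by apply/ideal_pow1/point_ideal_lform/vr; rewrite mem_head.
by apply: IHr => d dr; apply: vr; rewrite inE dr orbT.
Qed.

Lemma lsub_invK g p : g \in unitmx -> lsub (invmx g) (lsub g p) = p.
Proof. by move=> gU; rewrite lsub_comp mulVmx // lsub1. Qed.

Lemma lsubK_inv g p : g \in unitmx -> lsub g (lsub (invmx g) p) = p.
Proof. by move=> gU; rewrite lsub_comp mulmxV // lsub1. Qed.

Lemma frame_expansion g p : g \in unitmx ->
  p = \sum_(a <- msupp (lsub g p)) (lsub g p)@_a *: lsub (invmx g) 'X_[a].
Proof.
move=> gU; rewrite -[LHS](lsub_invK _ gU) [in LHS](mpolyE (lsub g p)).
rewrite (linear_sum (lsub (invmx g))).
by apply: eq_bigr => a _; rewrite [LHS]linearZ.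
Qed.

(** In frame coordinates the ideal of the point is generated by [X_1, ..., X_n], and its [k]-th
    power is spanned by the monomials of degree at least [k] in these variables. *)
Lemma ideal_pow_vord g k p : g \in unitmx ->
  ideal_pow (point_ideal (row ord0 g)) k p <-> vord k (lsub g p).
Proof.
move=> gU; split.
  apply: (@ideal_gen_min _ _ _ (fun p => vord k (lsub g p))).
  - by move=> a _; rewrite rmorph0 mcoeff0.
  - by move=> f h vf vh; rewrite rmorphD; apply: vordD.
  - by move=> f h vh; rewrite rmorphM; apply: (@vordM 0).
  move=> _ [f [If ->]]; rewrite rmorph_prod; apply: vord_prod => i.
  move: (f i) (If i); apply: (@ideal_gen_min _ _ _ (fun p => vord 1 (lsub g p))).
  - by move=> a _; rewrite rmorph0 mcoeff0.
  - by move=> q h vq vh; rewrite rmorphD; apply: vordD.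
  - by move=> q h vh; rewrite rmorphM; apply: (@vordM 0).
  move=> q [[d homq] qv]; apply: (@vord1_frame d); first exact: lsub_homog.
  by rewrite lsub_frame_eval.
move=> vp; rewrite (frame_expansion p gU); rewrite big_seq.
apply: ideal_gen_sum => a asupp; apply: ideal_genZ.
apply: (@ideal_pow_le _ _ _ _ (edeg a)).
  by rewrite leqNgt; apply/negP => /vp/eqP; rewrite mcoeff_eq0 asupp.
rewrite lsub_frame_seq; apply: ideal_genMl; rewrite -(size_frame_seq g).
by apply: ideal_pow_lforms; exact: frame_seq_dual.
Qed.

(* The class of [f] in [p^k / p^(k+1)] is a combination of products of [k]
   linear forms vanishing at the point, padded to degree [t] by a linear form
   that does not vanish there. *)
Lemma ideal_pow_lead g k t (Q : R -> Prop) : g \in unitmx ->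
  Q 0 -> (forall p q, Q p -> Q q -> Q (p + q)) ->
  (forall c p, Q p -> Q (c *: p)) ->
  (forall r, size r = k -> (forall c, c \in r -> row ord0 g *m c = 0) ->
     Q (lform (col ord0 (invmx g)) ^+ (t - k) * \prod_(c <- r) lform c)) ->
  (forall p, p \is t.-homog -> ideal_pow (point_ideal (row ord0 g)) k.+1 p -> Q p) ->
  forall p, p \is t.-homog -> ideal_pow (point_ideal (row ord0 g)) k p -> Q p.
Proof.
move=> gU Q0 QD QZ Qlead Qnext p homp /(ideal_pow_vord _ _ gU) vp.
rewrite (frame_expansion p gU) big_seq.
apply: big_ind => // a asupp; apply: QZ; have da : mdeg a = t.
  by move/(lsub_homog g)/dhomogP: homp => /(_ _ asupp).
have monoE : ideal_pow (point_ideal (row ord0 g)) (edeg a) (lsub (invmx g) 'X_[a]).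
  apply/ideal_pow_vord => //; rewrite lsubK_inv // => b ba.
  by rewrite mcoeffX; case: eqP => // ab; rewrite ab ltnn in ba.
have [ak|ka|ak] := ltngtP (edeg a) k.
- by move/eqP: (vp _ ak); rewrite mcoeff_eq0 asupp.
- apply: Qnext; last exact: ideal_pow_le ka monoE.
  by apply: lsub_homog; rewrite dhomogX; apply/eqP.
rewrite lsub_frame_seq (_ : a ord0 = t - k)%N; last first.
  by rewrite -da mdeg_edeg ak addnK.
by apply: Qlead; [rewrite size_frame_seq | exact: frame_seq_dual].
Qed.

(** In frame coordinates, monomials of degree at most [k] in [X_1, ..., X_n] are divisible by
    [X_0 ^+ (t - k)], and the others lie in the power [k.+1] of the ideal. With
    [frame_complement_free] this identifies the quotient in degree [t] with the forms of degree
    [k]. *)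
Lemma frame_complement_spans g t k p : g \in unitmx -> (k <= t)%N -> p \is t.-homog ->
  exists2 h, h \is k.-homog &
    ideal_pow (point_ideal (row ord0 g)) k.+1
              (p - lform (col ord0 (invmx g)) ^+ (t - k) * h).
Proof.
move=> gU kt homp; rewrite (frame_expansion p gU) big_seq.
set y := lform _; pose Q q := exists2 h, h \is k.-homog &
  ideal_pow (point_ideal (row ord0 g)) k.+1 (q - y ^+ (t - k) * h).
apply: (big_ind Q) => [|q1 q2 [h1 hom1 I1] [h2 hom2 I2]|a asupp].
- by exists 0; rewrite ?rpred0 // mulr0 subr0; apply: ideal_gen0.
- exists (h1 + h2); first exact: rpredD.
  by rewrite mulrDr opprD addrACA; apply: ideal_genD.
have da : mdeg a = t by move/(lsub_homog g)/dhomogP: homp => /(_ _ asupp).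
have [ka|ak] := ltnP k (edeg a).
  exists 0; rewrite ?rpred0 // mulr0 subr0; apply: ideal_genZ.
  apply/ideal_pow_vord => //; rewrite lsubK_inv // => b bk.
  by rewrite mcoeffX; case: eqP => // ab; rewrite ab in ka; lia.
exists ((lsub g p)@_a *: (y ^+ (k - edeg a) * \prod_(c <- frame_seq g a) lform c)).
  have hy := dhomogMn (k - edeg a) (lform_homog (col ord0 (invmx g))).
  have hp := dhomog_prod_seq (frame_seq g a) (fun c => lform_homog c).
  have := dhomogM hy hp; rewrite mul1n sum1_size size_frame_seq subnK //.
  exact: rpredZ.
rewrite -scalerAr -scalerBr; apply: ideal_genZ.
rewrite mulrA -exprD lsub_frame_seq -/y (_ : a ord0 = t - k + (k - edeg a))%N.
  by rewrite subrr; apply: ideal_gen0.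
by move: da; rewrite mdeg_edeg; lia.
Qed.

Lemma frame_complement_free g t k h : g \in unitmx -> (k <= t)%N -> h \is k.-homog ->
  ideal_pow (point_ideal (row ord0 g)) k.+1 (lform (col ord0 (invmx g)) ^+ (t - k) * h) ->
  h = 0.
Proof.
move=> gU kt homh /(ideal_pow_vord _ _ gU).
rewrite rmorphM rmorphXn /= lsub_lform colE mulmxA mulmxV // mul1mx.
have -> : lform (delta_mx ord0 0) = 'X_ord0 :> R.
  rewrite /lform (bigD1 ord0) //= mxE !eqxx scale1r big1 ?addr0 // => i i0.
  by rewrite mxE (negbTE i0) scale0r.
rewrite mpolyXn mulrC => vh; rewrite -(lsub_invK h gU).
rewrite (_ : lsub g h = 0) ?rmorph0 //; apply/mpolyP=> a; rewrite mcoeff0.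
have [da|da] := eqVneq (mdeg a) k; last first.
  exact: dhomog_nemf_coeff (lsub_homog g homh) da.
(* A monomial of degree [k] times a power of [X_0] has degree at most [k] in the other variables,
   where the coefficients vanish. *)
rewrite -(mcoeffMX _ (U_(ord0) *+ (t - k))%MM); apply: vh.
rewrite edegD /edeg mdegMn mdeg1 mulmnE mnm1E eqxx mul1n subnn; lia.
Qed.

End ProjectiveFrame.

(** * Codimension and separation of jets *)

Section Codimension.
Variables (K : fieldType) (vT : vectType K).
Implicit Types (U V W : {vspace vT}).

(** A subspace of maximal dimension inside [Q] is all of [Q], since adjoining another vector of [Q]
    would enlarge it. *)
Lemma vspace_of_prop (Q : vT -> Prop) :
  Q 0 -> (forall c u v, Q u -> Q v -> Q (c *: u + v)) ->
  exists V, forall u, u \in V <-> Q u.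
Proof.
move=> Q0 Qlin.
pose good d := `[< exists2 V : {vspace vT}, (forall u, u \in V -> Q u) & \dim V = d >].
have ex_good : exists d, good d.
  by exists 0%N; apply/asboolP; exists 0%VS; rewrite ?dimv0 // => u /[!memv0]/eqP->.
have good_le d : good d -> (d <= \dim {:vT})%N.
  by move=> /asboolP[V _ <-]; apply/dimvS/subvf.
case: (ex_maxnP ex_good good_le) => d /asboolP[V VQ dV] dmax.
exists V => u; split; first exact: VQ.
move=> Qu; have : good (\dim (<[u]> + V)).
  apply/asboolP; exists (<[u]> + V)%VS => // w /memv_addP[x /vlineP[c ->] [y yV ->]].
  by apply: Qlin => //; exact: VQ.
move/dmax; rewrite -dV => dle.
have /eqP -> : V == (<[u]> + V)%VS by rewrite eqEdim addvSr.
by apply: (subvP (addvSl _ V)); exact: memv_line.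
Qed.

Lemma hom_of_kernel V d : (\dim V + d = \dim {:vT})%N ->
  exists phi : 'Hom(vT, 'rV[K]_d), limg phi = fullv /\ lker phi = V.
Proof.
move=> Vd; pose C := (V^C)%VS; have dC : \dim C = d by rewrite dimv_compl; lia.
have CV0 : (C :&: V = 0)%VS by rewrite capvC capv_compl.
subst d; pose b := vbasis C; pose pi := daddv_pi C V.
pose f u : 'rV[K]_(\dim C) := \row_i coord b i (pi u).
have f_lin : linear f.
  by move=> c u v; apply/rowP=> i; rewrite !mxE !linearP.
pose lf := GRing.isLinear.Build _ _ _ _ f f_lin.
pose F : {linear vT -> 'rV[K]_(\dim C)} := HB.pack f lf.
have fE u : linfun F u = f u by rewrite lfunE.
have full : limg (linfun F) = fullv.
  apply/eqP; rewrite eqEsubv subvf /=; apply/subvP=> w _.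
  apply/memv_imgP; exists (\sum_i w 0 i *: b`_i); first exact: memvf.
  have bC : \sum_i w 0 i *: b`_i \in C.
    by apply: memv_suml => i _; rewrite memvZ // vbasis_mem // mem_nth // size_tuple.
  rewrite fE; apply/rowP=> i; rewrite mxE /pi daddv_pi_id // coord_sum_free //.
  exact/basis_free/vbasisP.
exists (linfun F); split=> //; apply/esym/eqP; rewrite eqEdim; apply/andP; split.
  apply/subvP=> u uV; rewrite memv_ker fE; apply/eqP/rowP=> i; rewrite !mxE.
  have : pi u + daddv_pi V C u = u.
    by rewrite /pi daddv_pi_add // addvC addv_complf memvf.
  rewrite (daddv_pi_id _ uV) ?capv_compl // -[X in _ = X]add0r => /addIr->.
  by rewrite linear0.
have := limg_ker_dim (linfun F) fullv; rewrite full capfv !dimvf dim_matrix.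
by move: Vd; rewrite dimvf /=; lia.
Qed.

Lemma codim_cap U V :
  (\dim {:vT} - \dim (U :&: V) + (\dim {:vT} - \dim (U + V)) =
   (\dim {:vT} - \dim U) + (\dim {:vT} - \dim V))%N.
Proof.
have := dimv_sum_cap U V; have := dimvS (subvf (U + V)%VS).
have := dimvS (subvf U); have := dimvS (subvf V).
have := dimvS (subvf (U :&: V)%VS); lia.
Qed.

Lemma sub_bigcapv_seq (I : eqType) (r : seq I) (V : I -> {vspace vT}) U :
  (forall i, i \in r -> (U <= V i)%VS) -> (U <= \bigcap_(i <- r) V i)%VS.
Proof.
elim: r => [|i r IHr] UV; first by rewrite big_nil subvf.
rewrite big_cons subv_cap UV ?mem_head //=; apply: IHr => j jr.
by apply: UV; rewrite inE jr orbT.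
Qed.

Lemma codim_bigcap_le (I : Type) (r : seq I) (p : pred I) (V : I -> {vspace vT}) :
  (\dim {:vT} - \dim (\bigcap_(i <- r | p i) V i)%VS <=
   \sum_(i <- r | p i) (\dim {:vT} - \dim (V i)))%N.
Proof.
elim: r => [|i r IHr]; first by rewrite !big_nil subnn.
rewrite !big_cons; case: (p i) => //.
have := codim_cap (V i) (\bigcap_(j <- r | p j) V j)%VS; lia.
Qed.

(** The linear form of the Chinese remainder theorem. When subspaces are intersected one at a time,
    [codim_cap] shows that the only loss is the codimension of a sum [V i + ...]. *)
Lemma codim_bigcap (I : finType) (V : I -> {vspace vT}) :
  (\dim {:vT} - \dim (\bigcap_i V i)%VS = \sum_i (\dim {:vT} - \dim (V i)))%N <->
  (forall i, V i + \bigcap_(j | j != i) V j = fullv)%VS.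
Proof.
split=> [codimE i|Vfull].
  have := codim_cap (V i) (\bigcap_(j | j != i) V j)%VS.
  move: codimE; rewrite !(bigD1 (P := xpredT) i) //= => ->.
  have := codim_bigcap_le (index_enum I) (fun j => j != i) V.
  move=> H1 H2; apply/eqP; rewrite eqEdim subvf /=; lia.
suff codimE (r : seq I) : uniq r ->
    (\dim {:vT} - \dim (\bigcap_(i <- r) V i)%VS =
     \sum_(i <- r) (\dim {:vT} - \dim (V i)))%N.
  by apply: codimE; rewrite index_enum_uniq.
elim: r => [|i r IHr] /=; first by rewrite !big_nil subnn.
case/andP=> ir /IHr{}IHr; rewrite !big_cons -IHr.
rewrite -codim_cap (_ : V i + _ = fullv)%VS ?subnn ?addn0 //.
apply/eqP; rewrite eqEsubv subvf /= -{1}(Vfull i); apply: addvS => //.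
apply: sub_bigcapv_seq => j jr; apply: (bigcapv_inf j) => //.
by apply: contraNneq ir => <-.
Qed.

End Codimension.

Section GradedPieces.
Variables (K : fieldType) (n : nat).
Notation R := {mpoly K[n.+1]}.
Implicit Types (I : R -> Prop) (v : 'rV[K]_n.+1).

Lemma dim_dhomog t : (\dim {:dhomog n.+1 K t} = 'C(t + n, n))%N.
Proof. by rewrite dimvf /dim /= -[in RHS]bin_sub ?leq_addl // addnK. Qed.

Lemma graded_piece (S : R -> Prop) t :
  exists V : {vspace dhomog n.+1 K t}, forall f, f \in V <-> ideal_gen S (val f).
Proof.
apply: vspace_of_prop; first exact: ideal_gen0.
by move=> c u w Su Sw; apply: ideal_genD => //; apply: ideal_genZ.
Qed.

Lemma graded_quotient_dimE I t d (V : {vspace dhomog n.+1 K t}) :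
  (forall f, f \in V <-> I (val f)) ->
  graded_quotient_dim I t d <-> (\dim V + d = \dim {:dhomog n.+1 K t})%N.
Proof.
move=> VI; split=> [[phi [phi_full phi_ker]]|/hom_of_kernel[phi [phi_full phi_ker]]].
  have <- : lker phi = V.
    by apply/vspaceP=> f; apply/idP/idP=> [/phi_ker/VI|/VI/phi_ker].
  have dd : \dim {:'rV[K]_d} = d by rewrite dimvf dim_matrix mul1r.
  by rewrite -(limg_ker_dim phi fullv) capfv phi_full dd.
by exists phi; split=> // f; rewrite phi_ker; apply: VI.
Qed.

Lemma codim_ideal_pow v m t (V : {vspace dhomog n.+1 K t}) :
  v != 0 -> (0 < m <= t.+1)%N ->
  (forall f, f \in V <-> ideal_pow (point_ideal v) m (val f)) ->
  (\dim {:dhomog n.+1 K t} - \dim V = 'C(m + n - 1, n))%N.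
Proof.
move=> /frame_exists[g gU <-]; case: m => // k kt1 VE; have {kt1} kt : (k <= t)%N by case/andP: kt1.
pose y := lform (col ord0 (invmx g)).
have homM (h : dhomog n.+1 K k) : y ^+ (t - k) * val h \is t.-homog.
  have hy := dhomogMn (t - k) (lform_homog (col ord0 (invmx g))).
  by have := dhomogM hy (valP h); rewrite mul1n subnK.
pose f h := DHomog (homM h).
have f_lin : linear f.
  by move=> c p q; apply: val_inj; rewrite /= mulrDr scalerAr.
pose lf := GRing.isLinear.Build _ _ _ _ f f_lin.
pose F : {linear dhomog n.+1 K k -> dhomog n.+1 K t} := HB.pack f lf.
have fE h : val (linfun F h) = y ^+ (t - k) * val h by rewrite lfunE.
pose C := limg (linfun F).
have CV0 : (C :&: V = 0)%VS.
  apply/eqP; rewrite -subv0; apply/subvP=> p /memv_capP[/memv_imgP[h _ ->]].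
  move/VE; rewrite fE => /(frame_complement_free gU kt (valP h)) h0.
  by rewrite memv0; apply/eqP/val_inj; rewrite fE h0 mulr0.
have CVf : (C + V = fullv)%VS.
  apply/eqP; rewrite eqEsubv subvf; apply/subvP=> p _.
  have [h homh ph] := frame_complement_spans gU kt (valP p).
  rewrite -[p](subrK (linfun F (DHomog homh))) addrC; apply: memv_add.
    by apply: memv_img; exact: memvf.
  by apply/VE; rewrite /= -/(val _) fE.
have dC : \dim C = 'C(k + n, n).
  rewrite /C limg_dim_eq ?dim_dhomog // capfv; apply/eqP/lker0P=> h1 h2.
  move/(congr1 val)/eqP; rewrite !fE -subr_eq0 -mulrBr => /eqP h0.
  apply/val_inj/eqP; rewrite -subr_eq0; apply/eqP.
  apply: (frame_complement_free gU kt); first by apply: rpredB; exact: valP.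
  by rewrite h0; apply: ideal_gen0.
have := dimv_sum_cap C V; rewrite CVf CV0 dimv0 dC addn0 => ->.
by rewrite addnK addSn subn1.
Qed.

(** When [t.+1 < m], the codimension is at most the dimension of the whole space of forms, which is
    smaller than the binomial since [0 < n]. *)
Lemma codim_ideal_pow_le v m t (V : {vspace dhomog n.+1 K t}) :
  v != 0 -> (0 < m)%N -> (0 < n)%N ->
  (forall f, f \in V <-> ideal_pow (point_ideal v) m (val f)) ->
  (\dim {:dhomog n.+1 K t} - \dim V <= 'C(m + n - 1, n) ?= iff (m <= t.+1))%N.
Proof.
move=> v0 m0 n0 VE; have [mt|tm] := leqP m t.+1.
  by split; rewrite (codim_ideal_pow v0 _ VE) ?m0 ?mt // eqxx.
have lt1 : ('C(t + n, n) < 'C(t.+1 + n, n))%N.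
  case: n n0 => // k _; rewrite addSn binS -[X in (X < _)%N]addn0 ltn_add2l.
  by rewrite bin_gt0; lia.
have le2 : ('C(t.+1 + n, n) <= 'C(m + n - 1, n))%N by apply: leq_bin2l; lia.
rewrite dim_dhomog; split; first lia.
by apply/eqP; lia.
Qed.

End GradedPieces.

(** The jets at one point that come from forms of degree [t] can be completed by zero jets at the
    other points. That all jets of order [m] at a single point arise in this way is the separate
    condition [m <= t.+1]. *)
Definition separates (K : fieldType) (n : nat) (I : finType) (P : I -> 'rV[K]_n.+1) m t :=
  forall i f, f \is t.-homog -> exists2 h, h \is t.-homog &
    ideal_pow (point_ideal (P i)) m (h - f) /\
    (forall j, j != i -> ideal_pow (point_ideal (P j)) m h).

Section Separation.
Variables (K : fieldType) (n : nat) (I : finType) (P : I -> 'rV[K]_n.+1) (m t : nat).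
Variable V : I -> {vspace dhomog n.+1 K t}.
Hypothesis VE : forall i f, f \in V i <-> ideal_pow (point_ideal (P i)) m (val f).

Lemma mem_bigcap_piece (p : pred I) f : f \in (\bigcap_(i | p i) V i)%VS <->
  forall i, p i -> ideal_pow (point_ideal (P i)) m (val f).
Proof.
rewrite memvE; split=> [/subv_bigcapP fV i pi|fV].
  by apply/VE; rewrite memvE; exact: fV.
by apply/subv_bigcapP=> i pi; rewrite -memvE; apply/VE/fV.
Qed.

Lemma separatesP : separates P m t <->
  (\dim {:dhomog n.+1 K t} - \dim (\bigcap_i V i)%VS =
   \sum_i (\dim {:dhomog n.+1 K t} - \dim (V i)))%N.
Proof.
rewrite codim_bigcap; split=> [sepP i|Vfull i f homf].
  apply/eqP; rewrite eqEsubv subvf; apply/subvP=> f _.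
  have [h homh [hi hj]] := sepP i (val f) (valP f).
  rewrite -[f](subrK (DHomog homh)); apply: memv_add.
    by rewrite -memvN opprB; apply/VE.
  by apply/mem_bigcap_piece => j ji; exact: hj.
have : DHomog homf \in (V i + \bigcap_(j | j != i) V j)%VS by rewrite Vfull memvf.
case/memv_addP=> u uV [h hV fE]; exists (val h); first exact: valP.
split; last exact/mem_bigcap_piece.
have -> : val h - f = val (- u) by rewrite -[f]/(val (DHomog homf)) fE /= opprD addrCA subrr addr0.
by apply/VE; rewrite memvN.
Qed.

End Separation.

Lemma quotient_dim_separates (K : fieldType) (n s m t : nat) (P : 'I_s -> 'rV[K]_n.+1) :
  (forall i, P i != 0) -> (0 < n)%N -> (0 < m)%N -> (0 < s)%N ->
  graded_quotient_dim (fat_ideal P (fun=> m)) t (multiplicity n (fun _ : 'I_s => m)) <->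
  (m <= t.+1)%N /\ separates P m t.
Proof.
move=> P0 n0 m0 s0.
have /choice[V VE] i : exists Vi : {vspace dhomog n.+1 K t},
    forall f, f \in Vi <-> ideal_pow (point_ideal (P i)) m (val f) by exact: graded_piece.
rewrite (@graded_quotient_dimE _ _ _ _ _ (\bigcap_i V i)%VS); last first.
  move=> f; rewrite (mem_bigcap_piece VE); split=> [fV i|fV i _]; exact: fV.
rewrite (separatesP VE) /multiplicity /=.
have codimV i := codim_ideal_pow_le (P0 i) m0 n0 (VE i).
have le1 := dimvS (subvf (\bigcap_(i < s) V i)%VS).
have le2 := codim_bigcap_le (index_enum 'I_s) xpredT V.
have [/= le3 /= eq3] := leqif_sum (fun i (_ : xpredT i) => codimV i).
(* The multiplicity bounds the sum of the local codimensions, which bounds the codimension of the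
   intersection; equality of the extremes forces equality at both steps. *)
have eqSN (A B S N : nat) :
  (B + N = A -> A - B <= S -> S <= N -> S = N /\ A - B = S)%N by lia.
have eqBN (A B S N : nat) :
  (B <= A -> S = N -> A - B = S -> B + N = A)%N by lia.
split=> [dimE|[mt codimE]].
  have [eq4 codimE] := eqSN _ _ _ _ dimE le2 le3; split; last exact: codimE.
  by move/eqP: eq4; rewrite eq3 => /forallP/(_ (Ordinal s0)).
by apply: eqBN le1 _ codimE; apply/eqP; rewrite eq3; apply/forallP=> i.
Qed.

(** * The upper bound *)

Section SpanRank.
Variables (K : fieldType) (n : nat) (I : finType) (P : I -> 'rV[K]_n.+1).
Implicit Types (A B : {set I}).

Definition pspan A := (\sum_(i in A) <<P i>>)%MS.
Definition prank A := \rank (pspan A).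

Lemma pspan_sub A i : i \in A -> (P i <= pspan A)%MS.
Proof.
by move=> iA; apply: submx_trans (sumsmx_sup i iA (submx_refl _)); rewrite genmxE.
Qed.

Lemma pspan_subP A m (W : 'M_(m, n.+1)) :
  reflect (forall i, i \in A -> (P i <= W)%MS) (pspan A <= W)%MS.
Proof.
by apply: (iffP sumsmx_subP) => AW i iA; have := AW i iA; rewrite genmxE.
Qed.

Lemma pspanS A B : A \subset B -> (pspan A <= pspan B)%MS.
Proof. by move=> AB; apply/pspan_subP => i /(subsetP AB); exact: pspan_sub. Qed.

Lemma pspanU A B : (pspan (A :|: B) :=: pspan A + pspan B)%MS.
Proof.
apply/eqmxP/andP; split.
  apply/pspan_subP => i /setUP[]/pspan_sub iA.
    exact: submx_trans iA (addsmxSl _ _).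
  exact: submx_trans iA (addsmxSr _ _).
by rewrite addsmx_sub !pspanS ?subsetUl ?subsetUr.
Qed.

Lemma prankS A B : A \subset B -> (prank A <= prank B)%N.
Proof. by move=> AB; apply/mxrankS/pspanS. Qed.

Lemma prank_le_card A : (prank A <= #|A|)%N.
Proof.
rewrite /prank /pspan -sum1_card; elim/big_ind2: _ => [|M a N b Ma Nb|i _].
- by rewrite mxrank0.
- by apply: leq_trans (leq_add Ma Nb); exact: mxrank_adds_leqif.
by rewrite mxrank_gen rank_rV; case: eqP.
Qed.

Lemma prank_submod A B : (prank (A :|: B) + prank (A :&: B) <= prank A + prank B)%N.
Proof.
rewrite -(mxrank_sum_cap (pspan A)) /prank (pspanU A B) leq_add2l; apply: mxrankS.
by rewrite sub_capmx !pspanS ?subsetIl ?subsetIr.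
Qed.

End SpanRank.

Section PointNullity.
Variables (K : fieldType) (n : nat) (E : finType) (v : 'rV[K]_n.+1) (Q : E -> 'rV[K]_n.+1).
Implicit Types (A B : {set E}).

Definition relrank A := \rank (v + pspan Q A)%MS.
(** For [v != 0] this is the nullity in the matroid of the points [Q] projected from [v], where [A]
    has rank [relrank A - 1]. *)
Definition nullity A := (#|A|.+1 - relrank A)%N.

Lemma relrank_le A B : A \subset B -> (relrank B + #|A| <= relrank A + #|B|)%N.
Proof.
move=> AB; have BE : B = A :|: B :\: A by rewrite -[LHS](setID B A) (setIidPr AB).
have : (relrank B <= relrank A + #|B :\: A|)%N.
  apply: leq_trans (leq_add (leqnn _) (prank_le_card Q (B :\: A))).
  apply: leq_trans (mxrank_adds_leqif _ _); apply: mxrankS.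
  rewrite addsmx_sub (submx_trans (addsmxSl _ _) (addsmxSl _ _)) [in pspan _ B]BE.
  rewrite pspanU addsmx_sub (submx_trans (addsmxSr _ _) (addsmxSl _ _)).
  exact: addsmxSr.
by rewrite -(cardsID A B) (setIidPr AB); lia.
Qed.

Lemma relrankS A B : A \subset B -> (relrank A <= relrank B)%N.
Proof. by move=> AB; apply/mxrankS/addsmxS => //; exact: pspanS. Qed.

Lemma relrank_le_card A : (relrank A <= #|A|.+1)%N.
Proof.
have := mxrank_adds_leqif v (pspan Q A); have := prank_le_card Q A.
rewrite /relrank /prank => H1 [H2 _].
by have : (\rank v <= 1)%N by [rewrite rank_rV; case: eqP]; lia.
Qed.

Lemma relrank_submod A B : (relrank (A :|: B) + relrank (A :&: B) <= relrank A + relrank B)%N.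
Proof.
rewrite {3 4}/relrank -mxrank_sum_cap; apply: leq_add; apply: mxrankS.
  rewrite addsmx_sub (submx_trans (addsmxSl _ _) (addsmxSl _ _)) pspanU addsmx_sub.
  rewrite (submx_trans (addsmxSr v (pspan Q A)) (addsmxSl _ _)).
  exact: submx_trans (addsmxSr v (pspan Q B)) (addsmxSr _ _).
by rewrite sub_capmx !addsmxS ?pspanS ?subsetIl ?subsetIr.
Qed.

Lemma nullity_supermod A B :
  (nullity A + nullity B <= nullity (A :|: B) + nullity (A :&: B))%N.
Proof.
have := relrank_submod A B; have := cardsUI A B; rewrite /nullity.
have := relrank_le_card A; have := relrank_le_card B.
have := relrank_le_card (A :|: B); have := relrank_le_card (A :&: B); lia.
Qed.

Lemma nullityS A B : A \subset B -> (nullity A <= nullity B)%N.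
Proof.
move=> AB; have := relrank_le AB; have := relrank_le_card A.
by have := relrank_le_card B; rewrite /nullity; lia.
Qed.

Lemma nullity_setD1 A x : (nullity A <= nullity (A :\ x) + 1)%N.
Proof.
have := relrankS (subD1set A x); have := cardsD1 x A; rewrite /nullity.
by have := relrank_le_card (A :\ x); case: (x \in A); lia.
Qed.

Lemma nullity0 : v != 0 -> nullity set0 = 0%N.
Proof.
move=> v_neq0; rewrite /nullity cards0; suff : (0 < relrank set0)%N by lia.
by apply: leq_trans (mxrankS (addsmxSl _ _)); rewrite rank_rV v_neq0.
Qed.

(** Nullity zero means that [v] and the points of [A] are linearly independent, so the matrix with
    these rows has a right inverse. *)
Lemma interpolation A (a : K) (w : E -> K) : nullity A = 0%N ->
  exists c : 'cV[K]_n.+1, (v *m c) 0 0 = a /\ forall x, x \in A -> (Q x *m c) 0 0 = w x.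
Proof.
move=> A0; pose M := col_mx v (\matrix_(i < #|A|) Q (enum_val i)).
have Mfree : row_free M.
  have : (relrank A <= \rank M)%N.
    apply: mxrankS; rewrite -addsmxE; apply: addsmxS => //.
    apply/pspan_subP => x xA.
    have <- : row (enum_rank_in xA x) (\matrix_(i < #|A|) Q (enum_val i)) = Q x.
      by rewrite rowK enum_rankK_in.
    exact: row_sub.
  by move: A0 (rank_leq_row M); rewrite /nullity /row_free => H1 H2 H3; apply/eqP; lia.
exists (pinvmx M *m col_mx a%:M (\col_(i < #|A|) w (enum_val i))).
have : M *m (pinvmx M *m col_mx a%:M (\col_(i < #|A|) w (enum_val i))) =
    col_mx a%:M (\col_(i < #|A|) w (enum_val i)).
  by rewrite mulmxA mulmxVp // mul1mx.
move: (pinvmx M *m _) => c; rewrite mul_col_mx => /eq_col_mx[-> Mc].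
split=> [|x xA]; first by rewrite mxE.
have /matrixP/(_ (enum_rank_in xA x) 0) := Mc; rewrite [RHS]mxE enum_rankK_in // => <-.
by rewrite !mxE; apply: eq_bigr => j _; rewrite !mxE enum_rankK_in.
Qed.

End PointNullity.

(** * Forms with a prescribed leading form at one point *)

Section LeadingForms.
Variables (K : fieldType) (n : nat) (E : finType) (g : 'M[K]_n.+1) (Q : E -> 'rV[K]_n.+1).
Hypothesis gU : g \in unitmx.
Notation v := (row ord0 g).
Notation nu := (nullity v Q).
Notation y := (lform (col ord0 (invmx g))).
Notation J := (point_ideal v).
Hypothesis nu_setT : (nu setT <= 2)%N.

Lemma frame_neq0 : v != 0.
Proof.
rewrite rowE; apply/eqP => /(congr1 (mulmxr (invmx g))) /=; rewrite mulmxK // mul0mx.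
by move/matrixP/(_ 0 ord0)/eqP; rewrite !mxE !eqxx oner_eq0.
Qed.

Lemma sum_subn (u : E -> nat) (O A : {set E}) : (forall x, x \in O -> 0 < u x)%N ->
  (\sum_(x in A) (u x - (x \in O)) + #|A :&: O| = \sum_(x in A) u x)%N.
Proof.
move=> uO; have -> : #|A :&: O| = (\sum_(x in A) (x \in O))%N.
  rewrite -sum1_card (eq_bigl (fun x => (x \in A) && (x \in O))) ?big_mkcondr //.
  by move=> x; rewrite inE.
rewrite -big_split /=; apply: eq_bigr => x _; rewrite subnK //.
by case: (boolP (x \in O)) => // /uO.
Qed.

Lemma mulmx_scalar_eq0 (w : 'rV[K]_n.+1) (c : 'cV_n.+1) : (w *m c) 0 0 = 0 -> w *m c = 0.
Proof. by move=> wc; apply/matrixP=> i j; rewrite !ord1 wc mxE. Qed.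

(** Outside [O] the new factor supplies the extra order of vanishing that the higher degree demands;
    on [O] the lowered weight has already paid for it. *)
Lemma lform_mul_vanish t (u : E -> nat) (O : {set E}) c G :
  (forall x, x \in O -> 0 < u x)%N ->
  (forall x, x \notin O -> Q x *m c = 0) ->
  (forall x, ideal_pow (point_ideal (Q x)) (t - (u x - (x \in O))) G) ->
  forall x, ideal_pow (point_ideal (Q x)) (t.+1 - u x) (lform c * G).
Proof.
move=> uO Qc QG x; have := QG x; case: (boolP (x \in O)) => [xO|xO] Gx.
  apply: ideal_genMl; apply: ideal_pow_le Gx.
  by have := uO x xO; case: (u x) => // a _; rewrite subSS subn1.
rewrite subn0 in Gx; apply: (@ideal_pow_le _ _ _ _ (1 + (t - u x))).
  by rewrite leq_subLR addnCA -maxnE addnC addn1 ltnS leq_maxr.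
by apply: ideal_powD => //; apply/ideal_pow1/point_ideal_lform/Qc.
Qed.

(** Induction on the degree, splitting off a linear form with the help of the basis [~: O] from
    [removable_exists]. For [k = 0] its hyperplane misses [v]; for [0 < k] it passes through [v] and
    supplies a factor of the leading form. *)
Lemma lead_exists t k u (r : seq 'cV[K]_n.+1) :
  (k <= t)%N ->
  (forall A, A != set0 -> nu A * t + k <= \sum_(x in A) u x)%N ->
  size r = k -> (forall c, c \in r -> v *m c = 0) ->
  exists2 G, G \is t.-homog &
    ideal_pow J k.+1 (G - y ^+ (t - k) * \prod_(c <- r) lform c) /\
    (forall x, ideal_pow (point_ideal (Q x)) (t - u x) G).
Proof.
have arith0 a b c d : (a + b + 0 + c <= d + a -> b + c <= d)%N by lia.
have arith1 a b c c' d k0 : (a + b + k0.+1 + c <= d + a -> c' <= c + 1 ->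
  b + k0 + c' <= d)%N by lia.
have arith2 a c k0 : (0 < a -> c <= a -> k0 + c <= a * k0.+1)%N by nia.
have nuU := nullity_supermod v Q; have nuS := @nullityS _ _ _ v Q.
have nuD := nullity_setD1 v Q; have nu0 := nullity0 Q frame_neq0.
elim: t k u r => [|t IHt] k u r kt u_le.
  move: kt; rewrite leqn0 => /eqP-> /size0nil-> _; exists 1; first exact: dhomog1.
  split=> [|x]; last by rewrite sub0n; apply: ideal_pow0.
  by rewrite big_nil expr0 mulr1 subrr; apply: ideal_gen0.
have k_le_u x : (k <= u x)%N.
  have := u_le [set x]; rewrite big_set1 => ux; apply: leq_trans (leq_addl _ _) (ux _).
  by apply/set0Pn; exists x; rewrite inE.
(* When [k] equals the degree, so does every weight at least, and nothing is required at the other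
   points: the product itself serves. *)
move: kt; rewrite leq_eqVlt => /predU1P[kt|kt] sz_r r0.
  exists (\prod_(c <- r) lform c).
    have := dhomog_prod_seq r (fun c => lform_homog c).
    by rewrite sum1_size sz_r kt.
  split=> [|x].
    by rewrite kt subnn mul1r subrr; apply: ideal_gen0.
  by have -> : (t.+1 - u x = 0)%N; [apply/eqP; rewrite subn_eq0 -kt | apply: ideal_pow0].
have [O [nuO uO u_O]] := removable_exists nuU nuS nuD kt u_le nu0 nu_setT.
case: k kt u_le sz_r k_le_u u_O => [|k] kt u_le sz_r k_le_u u_O.
  (* This linear form vanishes on [~: O] and is 1 at [v], hence agrees with [y] modulo the ideal of
     [v]. *)
  have [c [vc Qc]] := interpolation 1 (fun=> 0) nuO.
  have [A A0||G homG [vG QG]] := IHt 0%N (fun x => u x - (x \in O))%N [::] isT _ erefl.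
  - rewrite addn0 -(leq_add2r #|A :&: O|) sum_subn //.
    have [->|nuA] := posnP (nu A); first by rewrite mul0n -(sum_subn A uO) leq_addl.
    by apply: (@arith0 (nu A)); rewrite -mulnS; apply: u_O.
  - by [].
  rewrite (size0nil sz_r) big_nil mulr1 subn0.
  exists (lform c * G); first exact: dhomogM (lform_homog c) homG.
  split; last first.
    apply: lform_mul_vanish uO _ QG => x xO; apply/mulmx_scalar_eq0/Qc.
    by rewrite inE.
  have -> : lform c * G - y ^+ t.+1 = lform c * (G - y ^+ t) + (lform c - y) * y ^+ t.
    by rewrite exprS mulrBr mulrBl addrA subrK.
  apply: ideal_genD; first by apply: ideal_genMl; move: vG; rewrite big_nil mulr1 subn0.
  apply/ideal_genMr/ideal_pow1.
  rewrite -[- y]scaleN1r -lformZ -lformD; apply/point_ideal_lform/mulmx_scalar_eq0.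
  by rewrite mulmxDr -scalemxAr frame_dual0 // mxE vc !mxE !eqxx mulr1 subrr.
case: r sz_r r0 => // h r [sz_r] r0.
have vr c : c \in r -> v *m c = 0 by move=> cr; apply: r0; rewrite inE cr orbT.
rewrite big_cons subSS; set pr := \prod_(c <- r) _.
(* The admissible first factors form a linear space, so it is enough to split [h] into suitable
   summands. *)
pose good d := exists2 G, G \is t.+1.-homog &
  ideal_pow J k.+2 (G - y ^+ (t - k) * (lform d * pr)) /\
  (forall x, ideal_pow (point_ideal (Q x)) (t.+1 - u x) G).
have goodD c d : good c -> good d -> good (c + d).
  move=> [G homG [vG QG]] [H homH [vH QH]]; exists (G + H); first exact: rpredD.
  split=> [|x]; last by apply: ideal_genD; [exact: QG | exact: QH].
  by rewrite lformD mulrDl mulrDr opprD addrACA; apply: ideal_genD.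
have goodZ a c : good c -> good (a *: c).
  move=> [G homG [vG QG]]; exists (a *: G); first exact: rpredZ.
  split=> [|x]; last by apply: ideal_genZ; exact: QG.
  by rewrite lformZ -scalerAl -scalerAr -scalerBr; apply: ideal_genZ.
have good0 : good 0.
  exists 0; first exact: rpred0.
  split=> [|x]; last exact: ideal_gen0.
  by rewrite lform0 mul0r mulr0 subr0; apply: ideal_gen0.
(* Since [k] drops by one, [O'] may meet each set in one element more than [O] does. *)
have goodO d (O' : {set E}) : v *m d = 0 -> (forall x, x \notin O' -> Q x *m d = 0) ->
    (forall A, #|A :&: O'| <= #|A :&: O| + 1)%N -> good d.
  move=> vd Qd cardO'; have uO' x : x \in O' -> (0 < u x)%N.
    by move=> _; apply: leq_trans (k_le_u x).
  have [|A A0|||G homG [vG QG]] := IHt k (fun x => u x - (x \in O'))%N r.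
  - exact: ltnW.
  - rewrite -(leq_add2r #|A :&: O'|) sum_subn //.
    have [->|nuA] := posnP (nu A); last first.
      by apply: (@arith1 (nu A)) (cardO' A); rewrite -mulnS; apply: u_O.
    rewrite mul0n add0n; apply: leq_trans (_ : #|A| * k.+1 <= _)%N.
      by apply: arith2; rewrite ?card_gt0 // subset_leq_card // subsetIl.
    by rewrite -sum_nat_const; apply: leq_sum.
  - by [].
  - by [].
  exists (lform d * G); first exact: dhomogM (lform_homog d) homG.
  split; last exact: lform_mul_vanish uO' Qd QG.
  rewrite mulrCA -mulrBr; apply: (@ideal_powD _ _ _ 1) vG.
  exact/ideal_pow1/point_ideal_lform.
have /fin_all_exists[d dP] (x : E) := interpolation 0 (fun z => (z == x)%:R) nuO.
(* The [d x] vanish at [v] and are dual to the basis [~: O], so [h - h1] vanishes on [~: O] and is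
   handled with [O] itself. Each [d x] vanishes on [~: O] except at [x] and is handled with
   [x |: O]. *)
pose h1 := \sum_(x in ~: O) (Q x *m h) 0 0 *: d x.
suff : good h by [].
rewrite -[h](subrK h1); apply: (goodD).
  apply: (goodO _ O) => [|x xO|A]; last by rewrite leq_addr.
    rewrite mulmxBr r0 ?mem_head // mulmx_sumr big1 ?subrr // => x _.
    by rewrite -scalemxAr (mulmx_scalar_eq0 (dP x).1) scaler0.
  apply: mulmx_scalar_eq0.
  have -> : (Q x *m (h - h1)) 0 0 = (Q x *m h) 0 0 -
      \sum_(z in ~: O) (Q z *m h) 0 0 * (Q x *m d z) 0 0.
    rewrite mulmxBr mulmx_sumr [LHS]mxE [X in _ + X]mxE summxE; congr (_ - _).
    by apply: eq_bigr => z _; rewrite -scalemxAr [LHS]mxE.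
  have xCO : x \in ~: O by rewrite inE.
  rewrite (bigD1 x) //= (dP x).2 // eqxx mulr1 big1 ?addr0 ?subrr // => z /andP[_ zx].
  by rewrite (dP z).2 // eq_sym (negbTE zx) mulr0.
apply: (big_ind good) => // x xO; apply: goodZ.
apply: (goodO _ (x |: O)) => [|z|A].
- exact: mulmx_scalar_eq0 (dP x).1.
- rewrite !inE negb_or => /andP[zx zO]; apply: mulmx_scalar_eq0.
  by rewrite (dP x).2 ?inE // (negbTE zx).
apply: leq_trans (_ : #|x |: (A :&: O)| <= _)%N; last first.
  by rewrite cardsU1 addnC leq_add2l leq_b1.
by apply/subset_leq_card/subsetP=> z; rewrite !inE; case: (z == x); case: (z \in A).
Qed.

End LeadingForms.

(** Here [a] counts the points besides [v] and [rho] is the rank including [v], so [a.+1 - rho] is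
    the nullity in the projection from [v]. Segre's inequality becomes the hypothesis of
    [lead_exists] for the constant weight [t - m]. *)
Lemma segre_arith m t a rho k : (k < m)%N -> (m <= t.+1)%N -> (1 < rho <= a.+1)%N ->
  (m * a.+1 <= (rho - 1) * t + 1)%N -> ((a.+1 - rho) * t + k <= a * (t - m))%N.
Proof.
move=> km mt /andP[]; case: rho => [|[|r]] // _ ra.
have [e ->] : exists e, a = (r + 1 + e)%N by exists (a - (r + 1))%N; lia.
rewrite (_ : (r + 1 + e).+1 - r.+2 = e)%N; last by lia.
(* For [m = t.+1] the subtraction [t - m] truncates, but then Segre's inequality is
   contradictory. *)
clear ra; rewrite subn1 /=; move: mt; rewrite leq_eqVlt => /predU1P[mt|].
  by subst m; have := leq0n (t * e)%N; lia.
rewrite ltnS => /subnKC tE; rewrite -{1 2 3}tE; move: (t - m)%N => d; rewrite addKn.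
by have := leq0n (m * e)%N; lia.
Qed.

Section SegreBound.
Variables (K : fieldType) (n : nat) (I : finType) (P : I -> 'rV[K]_n.+1) (m t : nat).
Hypotheses (P_neq0 : forall i, P i != 0) (m_le : (m <= t.+1)%N).
Hypothesis P_distinct : forall i j, i != j -> (prank P [set i; j] = 2)%N.
Hypothesis card_le : (#|I| <= prank P setT + 2)%N.
Hypothesis segre : forall A, (1 < prank P A)%N -> (m * #|A| <= (prank P A - 1) * t + 1)%N.

Lemma relrank_prank i (A : {set {j | j != i}}) :
  relrank (P i) (fun j => P (val j)) A = prank P (i |: val @: A).
Proof.
apply/eqP; rewrite eqn_leq; apply/andP; split; apply: mxrankS.
  rewrite addsmx_sub pspan_sub ?setU11 //=; apply/pspan_subP => j jA.
  by apply: pspan_sub; rewrite inE imset_f ?orbT.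
apply/pspan_subP => j /setU1P[->|/imsetP[x xA ->]]; first exact: addsmxSl.
apply: submx_trans (addsmxSr _ _).
by apply: (@pspan_sub _ _ _ (fun j : {j | j != i} => P (val j)) A x).
Qed.

Lemma segre_separates : separates P m t.
Proof.
move=> i; have [g gU vE] := frame_exists (P_neq0 i).
pose Q (j : {j | j != i}) := P (val j).
have cardA (A : {set {j | j != i}}) : #|i |: val @: A| = #|A|.+1.
  have iA : i \notin val @: A.
    by apply/imsetP => -[j _ ij]; move: (valP j); rewrite -ij eqxx.
  by rewrite cardsU1 iA card_imset //; exact: val_inj.
have nuE A : nullity (row ord0 g) Q A = (#|i |: val @: A| - prank P (i |: val @: A))%N.
  by rewrite /nullity vE relrank_prank cardA.
have nuT : (nullity (row ord0 g) Q setT <= 2)%N.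
  rewrite nuE (_ : i |: _ = setT); first by rewrite cardsT; lia.
  apply/setP=> j; rewrite !inE; have [//|ji] := eqVneq j i.
  by apply/imsetP; exists (exist _ j ji).
have nu_le k A : (k < m)%N -> A != set0 ->
    (nullity (row ord0 g) Q A * t + k <= \sum_(x in A) (t - m))%N.
  move=> km /set0Pn[x xA].
  have rk2 : (1 < prank P (i |: val @: A))%N.
    rewrite -(P_distinct (i := i) (j := val x)); last by rewrite eq_sym; exact: (valP x).
    by apply: prankS; rewrite subUset !sub1set setU11 /= inE imset_f ?orbT.
  have := segre rk2; have := prank_le_card P (i |: val @: A).
  rewrite nuE sum_nat_const cardA => rkA; apply: segre_arith => //.
  by rewrite rk2.
pose sep f := exists2 h, h \is t.-homog & ideal_pow (point_ideal (P i)) m (h - f) /\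
  (forall j, j != i -> ideal_pow (point_ideal (P j)) m h).
have sep0 f : ideal_pow (point_ideal (P i)) m f -> sep f.
  move=> If; exists 0; first exact: rpred0.
  split=> [|j _]; last exact: ideal_gen0.
  by rewrite sub0r -scaleN1r; apply: ideal_genZ.
have sepD f1 f2 : sep f1 -> sep f2 -> sep (f1 + f2).
  move=> [h1 hom1 [i1 j1]] [h2 hom2 [i2 j2]]; exists (h1 + h2); first exact: rpredD.
  split=> [|j ji]; first by rewrite opprD addrACA; apply: ideal_genD.
  by apply: ideal_genD; [exact: j1 | exact: j2].
have sepZ c f : sep f -> sep (c *: f).
  move=> [h homh [ih jh]]; exists (c *: h); first exact: rpredZ.
  split=> [|j ji]; first by rewrite -scalerBr; apply: ideal_genZ.
  by apply: ideal_genZ; exact: jh.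
(* The jet at [P i] is treated one order at a time, starting from forms that already vanish to order
   [m]. *)
suff step k f : f \is t.-homog -> ideal_pow (point_ideal (P i)) (m - k) f -> sep f.
  by move=> f homf; apply: (step m) => //; rewrite subnn; apply: ideal_pow0.
elim: k f => [|k IHk] f homf; first by rewrite subn0; apply: sep0.
have [mk|km] := leqP m k; first by rewrite (_ : m - k.+1 = m - k)%N; [exact: IHk | lia].
set l := (m - k.+1)%N; have lE : (m - k = l.+1)%N by rewrite /l; lia.
have lm : (l < m)%N by rewrite /l; lia.
rewrite lE -vE in IHk; rewrite -vE; move: f homf.
apply: (ideal_pow_lead gU) => //; first by apply: sep0; apply: ideal_gen0.
move=> r sz_r r0.
have lt : (l <= t)%N by lia.
(* [G] has the required leading form, so the difference lies one power deeper, where the induction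
   hypothesis applies. *)
have [G homG [vG QG]] := lead_exists gU nuT lt (nu_le l ^~ lm) sz_r r0.
set f := _ * _; rewrite -[f](subrK G) addrC; apply: (sepD).
  exists G => //; split=> [|j ji]; first by rewrite subrr; apply: ideal_gen0.
  (* Segre's inequality for a pair of points ensures that [t - (t - m)] is really [m]. *)
  have mt : (m <= t)%N.
    have := @segre [set j; i]; rewrite P_distinct // cards2 ji => /(_ isT); lia.
  by have := QG (exist _ j ji); rewrite /= subKn.
apply: IHk.
  apply: rpredB => //; have hy := dhomogMn (t - l) (lform_homog (col ord0 (invmx g))).
  have hp := dhomog_prod_seq r (fun c => lform_homog c).
  by have := dhomogM hy hp; rewrite mul1n sum1_size sz_r subnK.
by rewrite -opprB -scaleN1r; apply: ideal_genZ.
Qed.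

End SegreBound.

(** * The lower bound from rational normal curves *)

Section CurveBound.
Variables (K : fieldType) (n : nat) (gam : 'I_n.+1 -> {poly K}).
Notation R := {mpoly K[n.+1]}.
Implicit Types (f : R) (v : 'rV[K]_n.+1) (x c : K).

Definition pull f : {poly K} := mmap (@polyC K) gam f.
HB.instance Definition _ := GRing.RMorphism.copy pull (mmap (@polyC K) gam).

Lemma pull_eval f x : (pull f).[x] = f.@[fun i => (gam i).[x]].
Proof.
rewrite /pull /mmap horner_sum mevalE; apply: eq_bigr => a _.
rewrite hornerM hornerC /mmap1 horner_prod; congr (_ * _).
by apply: eq_bigr => i _; rewrite horner_exp.
Qed.

Lemma pull_lform (d : 'cV[K]_n.+1) : pull (lform d) = \sum_i d i 0 *: gam i.
Proof.
rewrite /lform rmorph_sum /=; apply: eq_bigr => i _.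
by rewrite -mul_mpolyC rmorphM /= /pull mmapC mmapX mmap1U mul_polyC.
Qed.

Lemma size_pull f j t : (forall i, size (gam i) <= j.+1)%N -> f \is t.-homog ->
  (size (pull f) <= (j * t).+1)%N.
Proof.
move=> size_gam /dhomogP homf; rewrite /pull /mmap big_seq.
apply: (leq_trans (size_sum _ _ _)); apply/bigmax_leqP_seq => a asupp _.
rewrite mul_polyC; apply: leq_trans (size_scale_leq _ _) _.
have <- : mdeg a = t := homf _ asupp.
rewrite mdegE big_distrr /= /mmap1; elim/big_ind2: _ => [|p a1 q a2 pa qa|i _].
- by rewrite size_poly1.
- apply: leq_trans (size_polyMleq _ _) _; rewrite -subn1 leq_subLR.
  by apply: leq_trans (leq_add pa qa) _; rewrite addSn addnS add1n.
apply: leq_trans (size_poly_exp_leq _ _) _; rewrite ltnS leq_mul2r.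
by apply/orP; right; have := size_gam i; lia.
Qed.

Lemma meval_homogZ f d c v : f \is d.-homog ->
  f.@[fun i => c * v 0 i] = c ^+ d * f.@[fun i => v 0 i].
Proof.
move=> /dhomogP homf; rewrite !mevalE mulr_sumr; apply: eq_big_seq => a asupp.
have <- : mdeg a = d := homf _ asupp.
rewrite mdegE -prodrXr mulrCA -big_split /=; congr (_ * _).
by apply: eq_bigr => i _; rewrite exprMn.
Qed.

Lemma pull_ideal_pow v x c k f : (forall i, (gam i).[x] = c * v 0 i) ->
  ideal_pow (point_ideal v) k f -> ('X - x%:P) ^+ k %| pull f.
Proof.
move=> gx; apply: (@ideal_gen_min _ _ _ (fun f => _ %| pull f)).
- by rewrite rmorph0 dvdp0.
- by move=> p q pd qd; rewrite rmorphD dvdp_add.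
- by move=> p q; rewrite rmorphM; apply: dvdp_mull.
move=> _ [F [IF ->]]; rewrite rmorph_prod /=.
have -> : ('X - x%:P) ^+ k = \prod_(i < k) ('X - x%:P) by rewrite prodr_const card_ord.
elim/big_ind2: _ => [||i _]; [exact: dvdpp | move=> p1 q1 p2 q2 h1 h2; exact: dvdp_mul |].
move: (F i) (IF i); apply: (@ideal_gen_min _ _ _ (fun f => _ %| pull f)).
- by rewrite rmorph0 dvdp0.
- by move=> p q pd qd; rewrite rmorphD dvdp_add.
- by move=> p q; rewrite rmorphM; apply: dvdp_mull.
move=> p [[d homp] pv]; rewrite dvdp_XsubCl /root pull_eval.
by rewrite (meval_eq _ gx) (meval_homogZ _ _ homp) pv mulr0.
Qed.

Lemma dvdp_prod_XsubC (I : eqType) (tau : I -> K) (k : I -> nat) (r : seq I) (p : {poly K}) :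
  {in r &, injective tau} -> uniq r ->
  (forall a, a \in r -> ('X - (tau a)%:P) ^+ k a %| p) ->
  \prod_(a <- r) ('X - (tau a)%:P) ^+ k a %| p.
Proof.
elim: r => [|a r IHr] tau_inj /=; first by rewrite big_nil dvd1p.
case/andP=> ar ur ap; rewrite big_cons Gauss_dvdp; last first.
  rewrite big_seq; apply: (big_ind (coprimep _)) => [|p1 p2 c1 c2|b br].
  - exact: coprimep1.
  - by rewrite coprimepMr c1.
  apply/coprimep_expl/coprimep_expr; rewrite coprimep_XsubC root_XsubC.
  apply: contraNneq ar => /tau_inj <- //; first by rewrite inE br orbT.
  exact: mem_head.
rewrite ap ?mem_head //=; apply: IHr => //.
  by move=> b1 b2 b1r b2r; apply: tau_inj; rewrite inE ?b1r ?b2r orbT.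
by move=> b br; apply: ap; rewrite inE br orbT.
Qed.

Lemma pull_lform_sub (L l : 'cV[K]_n.+1) x : pull (lform L) = 1 -> pull (lform l) = 'X ->
  pull (lform (l - x *: L)) = 'X - x%:P.
Proof.
move=> L1 lX; rewrite lformD -scaleNr lformZ -mul_mpolyC rmorphD rmorphM /= L1 lX.
by rewrite /pull mmapC mulr1 /= rmorphN.
Qed.

(* Comparing degrees: the form separating the [m-1]-st order germ of the curve
   at one point from all other germs pulls back to a nonzero polynomial of
   degree at most [j * t] with [m * #|A| - 1] roots. *)
Lemma curve_bound (I : finType) (P : I -> 'rV[K]_n.+1) m t j (A : {set I})
    (tau : I -> K) (L l : 'cV[K]_n.+1) :
  separates P m t -> (0 < m <= t.+1)%N -> (forall i, size (gam i) <= j.+1)%N ->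
  pull (lform L) = 1 -> pull (lform l) = 'X -> {in A &, injective tau} ->
  (forall a, a \in A -> exists c, forall i, (gam i).[tau a] = c * P a 0 i) ->
  (m * #|A| <= j * t + 1)%N.
Proof.
move=> sepP /andP[m0 mt] size_gam L1 lX tau_inj gamP.
have [->|[a aA]] := set_0Vmem A; first by rewrite cards0 muln0.
(* The pullback of [f] is the power [m.-1] of ['X - tau a]; the factor [lform L] only pads the
   degree. *)
pose f := lform (l - tau a *: L) ^+ m.-1 * lform L ^+ (t - m.-1).
have homf : f \is t.-homog.
  have h1 := dhomogMn m.-1 (lform_homog (l - tau a *: L)).
  have h2 := dhomogMn (t - m.-1) (lform_homog L).
  by have := dhomogM h1 h2; rewrite !mul1n subnKC //; lia.
have [h homh [ha hA]] := sepP a f homf.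
have fE : pull f = ('X - (tau a)%:P) ^+ m.-1.
  by rewrite rmorphM !rmorphXn /= pull_lform_sub // L1 expr1n mulr1.
have [ca gama] := gamP a aA.
have pullB : pull (h - f) = pull h - ('X - (tau a)%:P) ^+ m.-1 by rewrite -fE; exact: rmorphB.
(* The pullback of [h] agrees with that power modulo the [m]-th one, so it is nonzero and has a root
   of order [m.-1] at [tau a]. *)
have := pull_ideal_pow gama ha; rewrite pullB => dvd_hf.
have h_neq0 : pull h != 0.
  apply: contraTneq dvd_hf => ->; rewrite sub0r dvdpNr dvdp_Pexp2l ?size_XsubC //.
  by rewrite -ltnNge prednK.
pose k b := if b == a then m.-1 else m.
have dvd_h b : b \in enum A -> ('X - (tau b)%:P) ^+ k b %| pull h.
  rewrite mem_enum /k => bA; case: eqP => [->|/eqP ba].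
    rewrite -(dvdp_subl _ (dvdpp _)); apply: dvdp_trans dvd_hf.
    by apply: dvdp_exp2l; exact: leq_pred.
  by have [c gamb] := gamP b bA; apply: pull_ideal_pow gamb (hA b ba).
have tau_inj' : {in enum A &, injective tau}.
  by move=> b1 b2; rewrite !mem_enum; exact: tau_inj.
have := dvdp_leq h_neq0 (dvdp_prod_XsubC tau_inj' (enum_uniq _) dvd_h).
rewrite size_prod_seq => [|b _]; last by rewrite expf_neq0 // polyXsubC_eq0.
move=> /leq_trans/(_ (size_pull size_gam homh)).
rewrite (eq_bigr (fun b => k b + 1)%N) => [|b _]; last by rewrite size_exp_XsubC addn1.
rewrite big_split /= sum1_size -addSn addnK ltnS big_enum /= => sum_le.
apply: leq_trans (_ : \sum_(b in A) k b + 1 <= _)%N; last by rewrite leq_add2r.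
rewrite mulnC -sum_nat_const (bigD1 a) //= [X in (_ <= X + 1)%N](bigD1 a) //= /k eqxx.
rewrite addnAC addn1 prednK // leq_add2l; apply: leq_sum => b /andP[_ /negbTE->].
exact: leqnn.
Qed.

End CurveBound.

(** * Rational normal curves through points in general position *)

Section LagrangeBasis.
Variables (K : fieldType) (I : finType) (B : {set I}) (tau : I -> K).
Hypothesis tau_inj : {in B &, injective tau}.

Definition node_poly b : {poly K} := \prod_(x <- enum (B :\ b)) ('X - (tau x)%:P).

Lemma size_node_poly b : b \in B -> size (node_poly b) = #|B|.
Proof. by move=> bB; rewrite size_prod_XsubC -cardE (cardsD1 b B) bB. Qed.

Lemma node_poly_root b x : x \in B -> x != b -> (node_poly b).[tau x] = 0.
Proof.
move=> xB xb; apply/eqP; rewrite -/(root _ _) /node_poly.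
rewrite -(big_map tau xpredT (fun z => 'X - z%:P)) root_prod_XsubC.
by apply: map_f; rewrite mem_enum !inE xb.
Qed.

Lemma node_poly_neq0 b : b \in B -> (node_poly b).[tau b] != 0.
Proof.
move=> bB; rewrite -/(root _ _) /node_poly.
rewrite -(big_map tau xpredT (fun z => 'X - z%:P)) root_prod_XsubC.
apply/mapP => -[x]; rewrite mem_enum !inE => /andP[xb xB] /tau_inj bx.
by rewrite bx ?eqxx in xb.
Qed.

Lemma lagrange_interpolation (q : {poly K}) : (size q <= #|B|)%N ->
  \sum_(b in B) (q.[tau b] / (node_poly b).[tau b]) *: node_poly b = q.
Proof.
move=> size_q; apply/eqP; rewrite -subr_eq0; apply: contraTT isT => d0.
have := @max_poly_roots _ _ [seq tau b | b <- enum B] d0.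
rewrite size_map -cardE map_inj_in_uniq ?enum_uniq; last first.
  by move=> b1 b2; rewrite !mem_enum; exact: tau_inj.
move=> /(_ _ isT) dB; suff: (#|B| < #|B|)%N by rewrite ltnn.
apply: leq_trans (dB _) _.
  apply/allP=> _ /mapP[b + ->]; rewrite mem_enum => bB.
  rewrite /root hornerD hornerN horner_sum (bigD1 b) //= hornerZ divfK ?node_poly_neq0 //.
  rewrite big1 ?addr0 ?subrr // => x /andP[xB xb].
  by rewrite hornerZ (node_poly_root bB) ?mulr0 // eq_sym.
apply: leq_trans (size_polyD _ _) _; rewrite geq_max size_polyN size_q andbT.
apply: leq_trans (size_sum _ _ _) _; apply/bigmax_leqP => b bB.
by apply: leq_trans (size_scale_leq _ _) _; rewrite size_node_poly.
Qed.

End LagrangeBasis.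

Section RationalNormalCurve.
Variables (K : fieldType) (n : nat) (I : finType) (P : I -> 'rV[K]_n.+1).

Lemma free_interpolation (A : {set I}) (w : I -> K) : prank P A = #|A| ->
  exists c : 'cV[K]_n.+1, forall x, x \in A -> (P x *m c) 0 0 = w x.
Proof.
move=> freeA; have [->|[a aA]] := set_0Vmem A.
  by exists 0 => x; rewrite inE.
have [|c [ca cA]] := @interpolation _ _ _ (P a) P (A :\ a) (w a) w.
  rewrite /nullity (cardsD1 a A) aA add1n in freeA *.
  apply/eqP; rewrite subn_eq0 -freeA; apply: mxrankS; apply/pspan_subP => x xA.
  have [->|xa] := eqVneq x a; first exact: addsmxSl.
  by apply: submx_trans (addsmxSr _ _); apply: pspan_sub; rewrite !inE xa.
by exists c => x xA; have [->//|xa] := eqVneq x a; apply: cA; rewrite !inE xa.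
Qed.

(* The curve [t |-> (c_b / (t - tau_b))_b], cleared of denominators: it passes
   through the coordinate point [P b] at [t = tau_b]. *)
Lemma rational_normal_curve_bound m t j (A B : {set I}) (tau c : I -> K) :
  separates P m t -> (0 < m <= t.+1)%N -> (0 < j)%N ->
  #|B| = j.+1 -> prank P B = #|B| -> {in A :|: B &, injective tau} ->
  (forall b, b \in B -> c b != 0) ->
  (forall a, a \in A -> a \notin B -> exists k u,
     P a = \sum_(b in B) u b *: P b /\
     forall b, b \in B -> c b = k * (tau a - tau b) * u b) ->
  (m * #|A| <= j * t + 1)%N.
Proof.
move=> sepP mt j0 cardB freeB tau_inj c0 AB.
have tauB : {in B &, injective tau}.
  by move=> b1 b2 b1B b2B; apply: tau_inj; rewrite inE ?b1B ?b2B orbT.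
have tauA : {in A &, injective tau}.
  by move=> b1 b2 b1B b2B; apply: tau_inj; rewrite inE ?b1B ?b2B.
pose pi b := node_poly B tau b.
pose gam i := \sum_(b in B) (c b * P b 0 i) *: pi b.
have pullE d : pull gam (lform d) = \sum_(b in B) (c b * (P b *m d) 0 0) *: pi b.
  rewrite pull_lform; under eq_bigr => i _ do rewrite scaler_sumr.
  rewrite exchange_big; apply: eq_bigr => b _ /=.
  under eq_bigr => i _ do rewrite scalerA.
  rewrite -scaler_suml mxE mulr_sumr; congr (_ *: _); apply: eq_bigr => i _.
  by rewrite mulrC mulrA.
(* The points of [B] are independent and the [pi b] span the polynomials of degree at most [j], so
   each of these is the pullback of a linear form. *)
have pull_onto (q : {poly K}) : (size q <= j.+1)%N -> exists d, pull gam (lform d) = q.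
  rewrite -cardB => size_q.
  have [d dP] := free_interpolation (fun b => q.[tau b] / (pi b).[tau b] / c b) freeB.
  exists d; rewrite pullE -[RHS](lagrange_interpolation tauB size_q).
  by apply: eq_bigr => b bB; rewrite dP // mulrC divfK ?c0.
have [|L L1] := pull_onto 1; first by rewrite size_poly1.
have [|l lX] := pull_onto 'X; first by rewrite size_polyX.
apply: (curve_bound sepP mt _ L1 lX tauA) => [i|a aA].
  apply: leq_trans (size_sum _ _ _) _; apply/bigmax_leqP => b bB.
  by apply: leq_trans (size_scale_leq _ _) _; rewrite size_node_poly ?cardB.
have gamE i x : (gam i).[x] = \sum_(b in B) c b * P b 0 i * (pi b).[x].
  by rewrite horner_sum; apply: eq_bigr => b _; rewrite hornerZ.
have [aB|aB] := boolP (a \in B).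
  exists (c a * (pi a).[tau a]) => i; rewrite gamE (bigD1 a) //= big1 ?addr0 1?mulrAC //.
  by move=> b /andP[bB ba]; rewrite node_poly_root ?mulr0 // eq_sym.
(* Clearing denominators multiplies by all [tau a - tau b]; the factor absent from [pi b] is
   supplied by [c b]. *)
have [k [u [aE cE]]] := AB a aA aB.
exists (k * \prod_(b in B) (tau a - tau b)) => i.
rewrite gamE aE summxE mulr_sumr; apply: eq_bigr => b bB; rewrite mxE cE //.
rewrite [in RHS](bigD1 b) //= /pi /node_poly horner_prod big_enum /=.
under eq_bigr => x _ do rewrite hornerXsubC.
rewrite (eq_bigl (fun x => (x \in B) && (x != b))) => [|x]; last by rewrite !inE andbC.
move: (\prod_(x in B | _) _) => p; rewrite -!mulrA; congr (_ * (_ * _)).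
by rewrite mulrA mulrC.
Qed.

End RationalNormalCurve.

Section LinearlyGeneralPosition.
Variables (K : fieldType) (n : nat) (I : finType) (P : I -> 'rV[K]_n.+1).
Hypothesis K_infinite : forall s : seq K, exists x, x \notin s.

Lemma injection_avoiding (s : seq K) : exists rho : I -> K,
  injective rho /\ forall i, rho i \notin s.
Proof.
have [r [ur sz_r rs]] : exists r : seq K,
    [/\ uniq r, size r = #|I| & forall x, x \in r -> x \notin s].
  elim: #|I| => [|k [r [ur sz_r rs]]]; first by exists [::].
  have [x] := K_infinite (r ++ s); rewrite mem_cat negb_or => /andP[xr xs].
  exists (x :: r); split=> /=; rewrite ?xr ?sz_r // => z.
  by rewrite inE => /predU1P[->//|]; exact: rs.
exists (fun i => r`_(enum_rank i)); split=> [i j /eqP|i]; last first.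
  by apply: rs; rewrite mem_nth // sz_r.
by rewrite nth_uniq ?sz_r // => /eqP/ord_inj/enum_rank_inj.
Qed.

(* With [s_b = lambda u_b / v_b] and [tau_b = 1 / (1 - s_b)], the curve reaches
   the point [u] at [t = 0] and the point [v] at [t = 1]. *)
Lemma two_extra_points_bound m t j (A B : {set I}) (u v : I -> K) x y :
  separates P m t -> (0 < m <= t.+1)%N -> (0 < j)%N ->
  #|B| = j.+1 -> prank P B = #|B| ->
  (forall b, b \in B -> u b != 0) -> (forall b, b \in B -> v b != 0) ->
  {in B &, injective (fun b => u b / v b)} ->
  (forall a, a \in A -> a \notin B ->
     a = x /\ P a = \sum_(b in B) u b *: P b \/
     [/\ a != x, a = y & P a = \sum_(b in B) v b *: P b]) ->
  (m * #|A| <= j * t + 1)%N.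
Proof.
move=> sepP mt j0 cardB freeB u0 v0 uv_inj AB.
(* The choice of [la] keeps [s b] away from 0, which would give [tau b = 1], and from 1, where
   [tau b] would be a pole. *)
have [la] := K_infinite (0 :: [seq v b / u b | b <- enum B]).
rewrite inE negb_or => /andP[la0 laB].
pose s b := la * (u b / v b).
have s0 b : b \in B -> s b != 0 by move=> bB; rewrite !mulf_neq0 ?invr_neq0 ?u0 ?v0.
have s1 b : b \in B -> 1 - s b != 0.
  move=> bB; rewrite subr_eq0; apply: contra laB => /eqP s1; apply/mapP.
  exists b; rewrite ?mem_enum //; have uv0 : u b / v b != 0 by rewrite mulf_neq0 ?invr_neq0 ?u0 ?v0.
  by apply: (mulIf uv0); rewrite -/(s b) -s1 -invf_div mulVf.
pose tau a := if a \in B then (1 - s a)^-1 else if a == x then 0 else 1.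
have tauB b : b \in B -> tau b = (1 - s b)^-1 by rewrite /tau => ->.
have tau_inj_B : {in B &, injective tau}.
  move=> b1 b2 b1B b2B; rewrite !tauB // => /invr_inj/addrI/oppr_inj/(mulfI la0).
  exact: uv_inj.
have tauB0 b : b \in B -> tau b != 0 by move=> bB; rewrite tauB // invr_neq0 ?s1.
have tauB1 b : b \in B -> tau b != 1.
  move=> bB; rewrite tauB // invr_eq1 subr_eq -subr_eq0 opprD addrA subrr.
  by rewrite sub0r oppr_eq0 s0.
(* Then [c b / (1 - tau b)] is [v b], and [- c b / tau b] is [la * u b]. *)
pose c b := v b * (1 - tau b).
apply: (@rational_normal_curve_bound _ _ _ P m t j A B tau c) => //.
- move=> a1 a2; rewrite !inE => a1AB a2AB.
  have [a1B|a1B] := boolP (a1 \in B); have [a2B|a2B] := boolP (a2 \in B).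
  + exact: tau_inj_B.
  + rewrite {2}/tau (negbTE a2B); case: eqP => _ /eqP; first by rewrite (negbTE (tauB0 _ a1B)).
    by rewrite (negbTE (tauB1 _ a1B)).
  + rewrite {1}/tau (negbTE a1B); case: eqP => _ /esym/eqP.
      by rewrite (negbTE (tauB0 _ a2B)).
    by rewrite (negbTE (tauB1 _ a2B)).
  rewrite /tau (negbTE a1B) (negbTE a2B).
  rewrite (negbTE a1B) orbF in a1AB; rewrite (negbTE a2B) orbF in a2AB.
  case: (AB _ a1AB a1B) => [[-> _]|[/negbTE-> a1y _]];
    case: (AB _ a2AB a2B) => [[-> _]|[/negbTE-> a2y _]]; rewrite ?eqxx //.
  * by move/eqP; rewrite eq_sym oner_eq0.
  * by move/eqP; rewrite oner_eq0.
  by rewrite a1y a2y.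
- by move=> b bB; rewrite mulf_neq0 ?v0 // subr_eq0 eq_sym tauB1.
move=> a aA aB; case: (AB a aA aB) => [[ax aE]|[ax _ aE]].
  exists la, u; split=> // b bB; rewrite /c tauB // {1}/tau (negbTE aB) ax eqxx sub0r.
  have vs : v b * s b = la * u b by rewrite /s mulrCA [v b * _]mulrC divfK ?v0.
  have e1 : 1 - (1 - s b)^-1 = - ((1 - s b)^-1 * s b).
    by rewrite -[X in X - _](mulVf (s1 b bB)) mulrBr mulr1 addrAC subrr sub0r.
  by rewrite e1 !mulrN mulNr mulrCA vs mulrCA mulrA.
exists 1, v; split=> // b bB; rewrite /c {2}/tau (negbTE aB) (negbTE ax) mul1r.
by rewrite mulrC.
Qed.

(** [j + 1] of the points serve as coordinate points, leaving at most two others. General position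
    makes the coordinates of these nonzero and, when there are two, their coordinate ratios
    distinct. *)
Lemma lgp_bound m t j (A : {set I}) :
  separates P m t -> (0 < m <= t.+1)%N -> (0 < j)%N -> prank P A = j.+1 ->
  (#|A| <= j + 3)%N ->
  (forall S : {set I}, S \subset A -> #|S| = j.+1 -> prank P S = j.+1) ->
  (m * #|A| <= j * t + 1)%N.
Proof.
move=> sepP mt j0 rkA cardA lgp.
have [B BA cardB] : exists2 B : {set I}, B \subset A & #|B| = j.+1.
  have jA : (j.+1 <= #|A|)%N by rewrite -rkA prank_le_card.
  exists [set x in take j.+1 (enum A)].
    by apply/subsetP=> x; rewrite inE => /mem_take; rewrite mem_enum.
  rewrite cardsE (card_uniqP _) ?take_uniq ?enum_uniq // size_take -cardE.
  by case: ltnP => // Aj; apply/eqP; rewrite eqn_leq Aj.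
have rkB := lgp B BA cardB.
have spanA : (pspan P A <= pspan P B)%MS.
  by have [_ <-] := mxrank_leqif_sup (pspanS P BA); rewrite -/(prank P A) -/(prank P B) rkA rkB.
have coord a : exists u : I -> K, a \in A -> P a = \sum_(b in B) u b *: P b.
  have [aA|aA] := boolP (a \in A); last by exists (fun=> 0).
  have /sub_sumsmxP[w wE] := submx_trans (pspan_sub P aA) spanA.
  have wP b : exists k, w b *m <<P b>>%MS = k *: P b.
    by apply/sub_rVP; apply: submx_trans (submxMl _ _) _; rewrite genmxE.
  have [k kP] := fin_all_exists wP.
  by exists k => _; rewrite wE; apply: eq_bigr.
have [u uE] := fin_all_exists coord.
have u0 a b : a \in A :\: B -> b \in B -> u a b != 0.
  rewrite inE => /andP[aB aA] bB; apply/eqP => uab.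
  have aBb : a \notin B :\ b by rewrite !inE negb_and aB orbT.
  have cardS : #|a |: B :\ b| = j.+1.
    by rewrite cardsU1 aBb -cardB (cardsD1 b B) bB.
  have SA : a |: B :\ b \subset A.
    by rewrite subUset sub1set aA (subset_trans _ BA) ?subD1set.
  have : (prank P (a |: B :\ b) <= prank P (B :\ b))%N.
    apply: mxrankS; apply/pspan_subP => x /setU1P[->|]; last exact: pspan_sub.
    rewrite (uE a aA) (bigD1 b) //= uab scale0r add0r; apply: summx_sub => z /andP[zB zb].
    by apply/scalemx_sub/pspan_sub; rewrite !inE zb.
  have := prank_le_card P (B :\ b); have := cardsD1 b B; rewrite bB.
  by rewrite (lgp _ SA cardS) cardB; lia.
(* Equal ratios at [b1] and [b2] would let a multiple of [P y] cancel both coordinates of [P x],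
   making the [j + 1] points [x], [y] and [B :\ b1 :\ b2] dependent. *)
have ratio x y : x \in A :\: B -> y \in A :\: B -> x != y ->
    {in B &, injective (fun b => u x b / u y b)}.
  move=> xAB yAB xy b1 b2 b1B b2B /= uxy; apply/eqP/negPn/negP => b12.
  have := u0 x _ xAB; have := u0 y _ yAB; move: xAB yAB; rewrite !inE => /andP[xB xA] /andP[yB yA].
  move=> uy0 ux0; pose C := B :\ b1 :\ b2.
  have CA : C \subset A by apply: subset_trans BA; rewrite /C !subDset !subsetU ?subxx ?orbT.
  have cardC : (#|C|.+2 = j.+1)%N.
    by rewrite -cardB (cardsD1 b1 B) b1B (cardsD1 b2 (B :\ b1)) !inE eq_sym b12 b2B.
  have yC : y \notin C by rewrite !inE (negbTE yB) !andbF.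
  have xyC : x \notin y |: C by rewrite !inE negb_or xy (negbTE xB) !andbF.
  have cardS : #|x |: (y |: C)| = j.+1 by rewrite !cardsU1 xyC yC -cardC.
  have SA : x |: (y |: C) \subset A by rewrite !subUset !sub1set xA yA CA.
  have : (prank P (x |: (y |: C)) <= prank P (y |: C))%N.
    apply: mxrankS; apply/pspan_subP => z /setU1P[->|]; last exact: pspan_sub.
    pose la := u x b1 / u y b1.
    have -> : P x = la *: P y + \sum_(b in C) (u x b - la * u y b) *: P b.
      have -> : \sum_(b in C) (u x b - la * u y b) *: P b =
                \sum_(b in B) (u x b - la * u y b) *: P b.
        rewrite [RHS](bigD1 b1) // [X in _ = _ + X](bigD1 b2) ?b2B 1?eq_sym //=.
        rewrite {1}/la divfK ?uy0 // subrr scale0r add0r.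
        rewrite /la uxy divfK ?uy0 // subrr scale0r add0r.
        by apply: eq_bigl => b; rewrite !inE; case: (b \in B); rewrite ?andbT ?andbF // andbC.
      under eq_bigr => b _ do rewrite scalerBl.
      rewrite sumrB -uE //; under [X in _ - X]eq_bigr => b _ do rewrite -scalerA.
      by rewrite -scaler_sumr -uE // addrC subrK.
    apply: addmx_sub; first by apply/scalemx_sub/pspan_sub; rewrite setU11.
    apply: summx_sub => b bC; apply/scalemx_sub/pspan_sub.
    by rewrite inE bC orbT.
  rewrite (lgp _ SA cardS) => /leq_trans/(_ (prank_le_card P _)).
  by rewrite cardsU1 yC -cardC ltnn.
have freeB : prank P B = #|B| by rewrite rkB.
have [rho [rho_inj rho0]] := injection_avoiding [:: 0].
have {}rho0 b : rho b != 0 by have := rho0 b; rewrite inE.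
have cardAB : (#|A :\: B| <= 2)%N.
  by have := cardsID B A; rewrite (setIidPr BA) cardB; lia.
(* With fewer than two extra points a fictitious second one is used, with coordinates [w b * rho b],
   whose ratios to the [w b] are distinct. *)
have one_point a (w : I -> K) : (forall b, b \in B -> w b != 0) ->
    (forall z, z \in A -> z \notin B -> z = a /\ P z = \sum_(b in B) w b *: P b) ->
    (m * #|A| <= j * t + 1)%N.
  move=> w0 AB; apply: (@two_extra_points_bound m t j A B w (fun b => w b * rho b) a a) => //.
  - by move=> b bB; rewrite mulf_neq0 ?w0.
  - move=> b1 b2 b1B b2B /=; rewrite !invfM !mulrA !mulfV ?w0 // !mul1r.
    by move/invr_inj/rho_inj.
  by move=> z zA zB; left; exact: AB.
case cAB : #|A :\: B| cardAB => [|[|[|//]]] _.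
- have AB z : z \in A -> z \notin B -> z \in A :\: B by move=> zA zB; rewrite inE zB.
  have b0 : exists b, b \in B by apply/set0Pn; rewrite -card_gt0 cardB.
  have [b bB] := b0; apply: (one_point b (fun=> 1)) => [*|z zA zB]; first exact: oner_neq0.
  by have := AB z zA zB; rewrite (cards0_eq cAB) inE.
- have /cards1P[x xE] : #|A :\: B| == 1%N by rewrite cAB.
  apply: (one_point x (u x)) => [b|z zA zB]; first by apply: u0; rewrite xE inE.
  have : z \in A :\: B by rewrite inE zB.
  by rewrite xE inE => /eqP zx; split=> //; rewrite -zx uE.
have /cards2P[x [y [xy xyE]]] : #|A :\: B| == 2 by rewrite cAB.
have xAB : x \in A :\: B by rewrite xyE !inE eqxx.
have yAB : y \in A :\: B by rewrite xyE !inE eqxx orbT.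
apply: (@two_extra_points_bound m t j A B (u x) (u y) x y) => //.
- by move=> b; exact: u0.
- by move=> b; exact: u0.
- exact: ratio.
move=> z zA zB; have : z \in A :\: B by rewrite inE zB.
rewrite xyE => /set2P[zx|zy]; [left | right]; first by rewrite -zx uE.
by rewrite zy eq_sym xy uE // -zy.
Qed.

End LinearlyGeneralPosition.

(** * Restriction to a subspace and the exceptional cubic *)

Section Restriction.
Variable K : fieldType.

Lemma lsub_ideal_pow k n (M : 'M[K]_(k.+1, n.+1)) (p : 'rV_k.+1) m f :
  ideal_pow (point_ideal (p *m M)) m f -> ideal_pow (point_ideal p) m (lsub M f).
Proof.
apply: (@ideal_gen_min _ _ _ (fun f => ideal_pow (point_ideal p) m (lsub M f))).
- by rewrite rmorph0; apply: ideal_gen0.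
- by move=> f1 f2; rewrite rmorphD; apply: ideal_genD.
- by move=> f1 f2; rewrite rmorphM; apply: ideal_genMl.
move=> _ [F [IF ->]]; rewrite rmorph_prod; apply: ideal_gen_mem.
exists (fun i => lsub M (F i)); split=> // i; move: (F i) (IF i).
apply: (@ideal_gen_min _ _ _ (fun f => point_ideal p (lsub M f))).
- by rewrite rmorph0; apply: ideal_gen0.
- by move=> f1 f2; rewrite rmorphD; apply: ideal_genD.
- by move=> f1 f2; rewrite rmorphM; apply: ideal_genMl.
move=> f0 [[d homf] fp]; apply: ideal_gen_mem.
by split; [exists d; exact: lsub_homog | rewrite lsub_eval].
Qed.

(** A form on the subspace is extended by [pinvmx M], separated in the ambient space and restricted
    again. *)
Lemma separates_restrict k n (I E : finType) (P : I -> 'rV[K]_n.+1)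
    (p : E -> 'rV[K]_k.+1) (M : 'M_(k.+1, n.+1)) (iota : E -> I) m t :
  separates P m t -> row_free M -> injective iota -> (forall z, P (iota z) = p z *m M) ->
  separates p m t.
Proof.
move=> sepP freeM iota_inj pM i f homf.
have [h homh [hi hj]] := sepP (iota i) _ (lsub_homog (pinvmx M) homf).
exists (lsub M h); first exact: lsub_homog.
split=> [|j ji]; last by apply: lsub_ideal_pow; rewrite -pM; apply: hj; rewrite (inj_eq iota_inj).
have -> : lsub M h - f = lsub M (h - lsub (pinvmx M) f).
  by rewrite rmorphB /= lsub_comp mulmxVp // lsub1.
by apply: lsub_ideal_pow; rewrite -pM.
Qed.

Lemma lform_eq0 n (c : 'cV[K]_n) : lform c = 0 -> c = 0.
Proof.
move=> c0; apply/colP=> i; rewrite mxE.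
have := lform_eval c (delta_mx 0 i); rewrite c0 raddf0 -rowE !mxE => <-.
by [].
Qed.

Lemma ideal_pow_prod_exp k (v : 'rV[K]_k.+1) (J : finType) (F : J -> {mpoly K[k.+1]})
    (e : J -> nat) : (forall j, point_ideal v (F j)) ->
  ideal_pow (point_ideal v) (\sum_j e j) (\prod_j F j ^+ e j).
Proof.
move=> IF; elim/big_ind2: _ => [|a f b h If Ih|j _]; first exact: ideal_pow0.
  exact: ideal_powD.
exact: ideal_powX.
Qed.

Lemma separates_dim k (I : finType) (P : I -> 'rV[K]_k.+1) m t :
  (forall i, P i != 0) -> (0 < m <= t.+1)%N -> separates P m t ->
  exists V : {vspace dhomog k.+1 K t},
    (forall f, f \in V <-> forall i, ideal_pow (point_ideal (P i)) m (val f)) /\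
    (#|I| * 'C(m + k - 1, k) + \dim V = 'C(t + k, k))%N.
Proof.
move=> P0 mt sepP.
have /choice[V VE] i : exists Vi : {vspace dhomog k.+1 K t},
    forall f, f \in Vi <-> ideal_pow (point_ideal (P i)) m (val f) by exact: graded_piece.
exists (\bigcap_i V i)%VS; split=> [f|].
  by rewrite (mem_bigcap_piece VE); split=> fV i; [exact: fV | move=> _; exact: fV].
have := (separatesP VE).1 sepP.
rewrite (eq_bigr (fun=> 'C(m + k - 1, k))%N) => [|i _]; last exact: codim_ideal_pow (VE i).
rewrite sum_nat_const dim_dhomog => <-; rewrite subnK //.
by rewrite -(dim_dhomog K); apply/dimvS/subvf.
Qed.

Lemma quadric_through k (E : finType) (p : E -> 'rV[K]_k.+1) (S : {set E}) :
  (#|S| < 'C(2 + k, k))%N ->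
  exists2 q : {mpoly K[k.+1]}, q != 0 & q \is 2.-homog /\
    forall z, z \in S -> q.@[fun i => p z 0 i] = 0.
Proof.
move=> cardS; pose ev (q : dhomog k.+1 K 2) : 'rV[K]_#|S| :=
  \row_i (val q).@[fun j => p (enum_val i) 0 j].
have ev_lin : linear ev.
  by move=> c q1 q2; apply/rowP=> i; rewrite !mxE /= mevalD mevalZ.
pose lf := GRing.isLinear.Build _ _ _ _ ev ev_lin.
pose F : {linear dhomog k.+1 K 2 -> 'rV[K]_#|S|} := HB.pack ev lf.
have : lker (linfun F) != 0%VS.
  apply/eqP => ker0; have := limg_ker_dim (linfun F) fullv.
  rewrite capfv ker0 dimv0 add0n dim_dhomog => dim_img.
  have dd : \dim {:'rV[K]_#|S|} = #|S| by rewrite dimvf dim_matrix mul1r.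
  have := dimvS (subvf (limg (linfun F))); rewrite dim_img dd.
  by rewrite leqNgt cardS.
rewrite -vpick0 => q0; exists (val (vpick (lker (linfun F)))).
  by apply: contra q0 => /eqP q0; apply/eqP/val_inj.
split=> [|z zS]; first exact: valP.
have := memv_pick (lker (linfun F)); rewrite memv_ker lfunE => /eqP/rowP/(_ (enum_rank_in zS z)).
by rewrite !mxE enum_rankK_in.
Qed.

End Restriction.

(** Geometrically [M] is the projection with centre [W], obtained from the cokernel, and [D] is a
    section of it. *)
Lemma projection_exists (K : fieldType) (N : nat) (W : 'M[K]_N) :
  (\rank W < N)%N -> exists k (M : 'M_(N, k.+1)) (D : 'M_(k.+1, N)),
    [/\ (N <= \rank W + k.+1)%N, D *m M = 1%:M &
        forall q : 'rV_N, (q <= W)%MS -> q *m M = 0].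
Proof.
move=> rkW; have rkC := mxrank_coker W.
have /row_fullP[D DM] := col_base_full (cokermx W).
have M0 (q : 'rV_N) : (q <= W)%MS -> q *m col_base (cokermx W) = 0.
  rewrite submxE -{1}(mulmx_base (cokermx W)) mulmxA => /eqP q0.
  by apply: (row_free_inj (row_base_free (cokermx W))); rewrite q0 mul0mx.
case: (\rank (cokermx W)) (col_base _) D DM M0 rkC => [|k] M D DM M0 rkC.
  by move: rkC rkW; lia.
by exists k, M, D; split=> //; move: rkC; lia.
Qed.

(* If five of seven points of [P^4] lie on a hyperplane, the union of the
   hyperplane with a quadric cone through them, having the line joining the two
   other points as vertex, is a cubic singular at all seven points. *)
Lemma seven_points_bound (K : fieldType) (E : finType) (p : E -> 'rV[K]_5) (S : {set E}) :
  (forall z, p z != 0) -> #|E| = 7%N -> #|S| = 5%N -> (prank p S <= 4)%N ->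
  ~ separates p 2 3.
Proof.
move=> p0 cardE cardS rkS /(separates_dim (m := 2) (t := 3) p0 isT)[V [VE]].
(* Under separation, seven double points impose 7 * 5 = 35 conditions, the dimension of the space of
   cubics, so no nonzero cubic is singular at all of them. *)
rewrite cardE => dimV; have {}dimV : \dim V = 0%N.
  by move: dimV; rewrite (_ : 'C(2 + 4 - 1, 4) = 5%N) // (_ : 'C(3 + 4, 4) = 35%N) //; lia.
have [c c0 cS] : exists2 c : 'cV[K]_5, c != 0 & forall z, z \in S -> p z *m c = 0.
  have : cokermx (pspan p S) != 0.
    by rewrite -mxrank_eq0 mxrank_coker subn_eq0 -ltnNge ltnS.
  case/matrix0Pn=> i [j cij]; exists (col j (cokermx (pspan p S))).
    by apply/matrix0Pn; exists i, 0; rewrite mxE.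
  move=> z zS; have := pspan_sub p zS; rewrite submxE => /eqP z0.
  by rewrite colE mulmxA z0 mul0mx.
have rkW : (prank p (~: S) <= 2)%N.
  by apply: leq_trans (prank_le_card _ _) _; rewrite cardsCs setCK cardE cardS.
have [|k [N [D [kN DN N0]]]] := @projection_exists K 5 (pspan p (~: S)).
  exact: leq_ltn_trans rkW _.
have k2 : (2 <= k)%N by move: kN rkW; rewrite /prank; lia.
(* The target has at least three coordinates, so its quadrics have dimension at least 6 and one of
   them passes through the five images. *)
have [|q q0 [homq qS]] := @quadric_through K k E (fun z => p z *m N) S.
  rewrite cardS -bin_sub ?leq_addl // addnK.
  by apply: leq_trans (leq_bin2l 2 (_ : 4 <= _)%N); last by lia.
have homf : lform c * lsub N q \is 3.-homog.
  exact: dhomogM (lform_homog c) (lsub_homog N homq).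
suff : DHomog homf \in V.
  have /eqP -> : V == 0%VS by rewrite -dimv_eq0 dimV.
  rewrite memv0 => /eqP/(congr1 val)/eqP /=; rewrite mulf_eq0 => /orP[/eqP/lform_eq0 cE|/eqP qE].
    by rewrite cE eqxx in c0.
  by move: q0; rewrite -(lsub1 q) -DN -lsub_comp qE rmorph0 eqxx.
apply/VE => z /=; have [zS|zS] := boolP (z \in S).
  rewrite -[2%N]/(1 + 1)%N; apply: ideal_powD; apply: ideal_pow1.
    exact/point_ideal_lform/cS.
  apply: ideal_gen_mem; split; first by exists 2%N; exact: lsub_homog.
  by rewrite lsub_eval qS.
(* The other two points project to zero, so each quadratic monomial pulls back to a product of two
   linear forms vanishing there. *)
apply: ideal_genMl; rewrite [q]mpolyE linear_sum big_seq.
apply: ideal_gen_sum => a asupp; rewrite linearZ; apply: ideal_genZ.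
have da : mdeg a = 2%N by move/dhomogP: homq => /(_ _ asupp).
have : ideal_pow (point_ideal (p z)) (mdeg a) (lsub N 'X_[a]).
  rewrite lsub_XM mdegE; apply: ideal_pow_prod_exp => i.
  apply: point_ideal_lform; rewrite colE mulmxA N0 ?mul0mx //.
  by apply: pspan_sub; rewrite inE.
by rewrite da.
Qed.

(** Euclid's argument: a root of [p + 1] is not a root of [p]. *)
Lemma closed_field_infinite (K : closedFieldType) (s : seq K) : exists x, x \notin s.
Proof.
case: s => [|a s]; first by exists 0.
pose p : {poly K} := \prod_(b <- a :: s) ('X - b%:P).
have size_p : size (p + 1) = (size s).+2.
  by rewrite size_polyDl size_prod_XsubC // size_poly1.
have /closed_rootP[x px] : size (p + 1) != 1%N by rewrite size_p.
exists x; apply: contraTN px => xs; rewrite /root hornerD hornerC.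
by move: xs; rewrite -root_prod_XsubC => /eqP->; rewrite add0r oner_eq0.
Qed.

(** * Segre's inequalities from separation, rank by rank *)

Section LowerBound.
Variables (K : fieldType) (n : nat) (I : finType) (P : I -> 'rV[K]_n.+1) (m t : nat).
Hypothesis K_infinite : forall s : seq K, exists x, x \notin s.
Hypothesis P_neq0 : forall i, P i != 0.
Hypothesis P_distinct : forall i j, i != j -> prank P [set i; j] = 2%N.
Hypothesis P_full : prank P setT = n.+1.
Hypothesis card_le : (#|I| <= n + 3)%N.
Hypothesis sepP : separates P m t.
Hypothesis mt : (0 < m <= t.+1)%N.
Implicit Types A S : {set I}.

Lemma prank_nullity A : (prank P setT + #|A| <= prank P A + #|I|)%N.
Proof.
have := prank_submod P A (~: A); rewrite setUCr setICr.
by have := prank_le_card P (~: A); have := cardsC A; lia.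
Qed.

Lemma card_le_prank A : (#|A| <= prank P A + 2)%N.
Proof. by have := prank_nullity A; rewrite P_full; have := card_le; lia. Qed.

Lemma prank_gt1 A : (1 < #|A|)%N -> (1 < prank P A)%N.
Proof.
move=> /card_gt1P[x [y [xA yA xy]]]; rewrite -(P_distinct xy).
by apply: prankS; rewrite subUset !sub1set xA.
Qed.

(** Corank at most two gives [#|A| <= j + 3], so [lgp_bound] applies unless some [j + 1] points are
    dependent. *)
Lemma lgp_bound_or A j : (0 < j)%N -> prank P A = j.+1 ->
  (m * #|A| <= j * t + 1)%N \/
  exists S, [/\ S \subset A, #|S| = j.+1 & (prank P S <= j)%N].
Proof.
move=> j0 rkA.
have [/forallP lgp|] :=
  boolP [forall S : {set I}, (S \subset A) && (#|S| == j.+1) ==> (prank P S == j.+1)].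
  left; apply: (lgp_bound K_infinite sepP mt j0 rkA) => [|S SA cardS].
    by have := card_le_prank A; rewrite rkA addSnnS.
  by apply/eqP; have := lgp S; rewrite SA cardS eqxx.
move=> /forallPn[S]; rewrite negb_imply => /andP[/andP[SA /eqP cardS] rkS]; right.
exists S; split=> //; rewrite -ltnS ltn_neqAle rkS /=.
by rewrite -cardS prank_le_card.
Qed.

Lemma bound_rank2 A : prank P A = 2%N -> (m * #|A| <= t + 1)%N.
Proof.
move=> rkA; have [|[S [SA cardS rkS]]] := lgp_bound_or (j := 1) isT rkA.
  by rewrite mul1n.
by have := prank_gt1 (A := S); rewrite cardS => /(_ isT); lia.
Qed.

Lemma bound_pair (i j : I) : i != j -> (2 * m <= t + 1)%N.
Proof. by move=> ij; have := bound_rank2 (P_distinct ij); rewrite cards2 ij mulnC. Qed.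

(** Outside general position three points are collinear, so [3 * m <= t + 1], and [#|A| <= 5] does
    the rest. Rank four is similar, with four coplanar points and [#|A| <= 6]. *)
Lemma bound_rank3 A : prank P A = 3%N -> (m * #|A| <= 2 * t + 1)%N.
Proof.
move=> rkA; have [//|[S [SA cardS rkS]]] := lgp_bound_or (j := 2) isT rkA.
have rkS2 : prank P S = 2%N by have := prank_gt1 (A := S); rewrite cardS => /(_ isT); lia.
have := bound_rank2 rkS2; rewrite cardS => mS; have := card_le_prank A.
rewrite rkA => A5; apply: leq_trans (_ : m * 5 <= _)%N; last by lia.
by rewrite leq_mul2l A5 orbT.
Qed.

Lemma bound_rank_le3 A : (1 < prank P A <= 3)%N -> (m * #|A| <= 2 * t + 1)%N.
Proof.
case/andP=> rk1 rk3; have [rkA|rkA] := eqVneq (prank P A) 3%N; first exact: bound_rank3.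
have rkA2 : prank P A = 2%N by lia.
by apply: leq_trans (bound_rank2 rkA2) _; lia.
Qed.

Lemma bound_rank4 A : prank P A = 4%N -> (m * #|A| <= 3 * t + 1)%N.
Proof.
move=> rkA; have [//|[S [SA cardS rkS]]] := lgp_bound_or (j := 3) isT rkA.
have rkS2 : (1 < prank P S <= 3)%N by rewrite rkS prank_gt1 ?cardS.
have := bound_rank_le3 rkS2; rewrite cardS => mS; have := card_le_prank A.
rewrite rkA => A6; apply: leq_trans (_ : m * 6 <= _)%N; last by lia.
by rewrite leq_mul2l A6 orbT.
Qed.

Lemma hyperplane_five_bound A S : m = 2%N -> t = 3%N -> prank P A = 5%N ->
  #|A| = 7%N -> S \subset A -> #|S| = 5%N -> (prank P S <= 4)%N -> False.
Proof.
move=> m2 t3 rkA cardA SA cardS rkS.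
have := row_base_free (pspan P A); have := eq_row_base (pspan P A).
move: (row_base _); rewrite -/(prank P A) rkA => M ME freeM.
pose p (z : {z | z \in A}) := P (val z) *m pinvmx M.
have pM z : P (val z) = p z *m M.
  by rewrite /p mulmxKpV // ME pspan_sub //; exact: (valP z).
pose S' := [set z : {z | z \in A} | val z \in S].
have cardE : #|{: {z | z \in A}}| = 7%N by rewrite card_sig.
have cardS' : #|S'| = 5%N.
  rewrite -(card_imset _ val_inj) -cardS; apply: eq_card => z.
  apply/imsetP/idP => [[w + ->]|zS]; first by rewrite inE.
  by exists (exist _ z (subsetP SA z zS)) => //; rewrite inE.
have p0 z : p z != 0.
  by apply: contra (P_neq0 (val z)) => /eqP z0; rewrite pM z0 mul0mx.
have rkS' : (prank p S' <= 4)%N.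
  apply: leq_trans rkS; rewrite /prank -(mxrankMfree _ freeM); apply: mxrankS.
  rewrite /pspan sumsmxMr_gen; apply/sumsmx_subP => z; rewrite inE => zS.
  by rewrite genmxE (eqmxMr _ (genmxE _)) -pM; apply: pspan_sub.
apply: (seven_points_bound p0 cardE cardS' rkS').
by have := separates_restrict sepP freeM val_inj pM; rewrite m2 t3.
Qed.

(** Outside general position, pairs give [2 * m <= t + 1], which with [#|A| <= 7] leaves only
    [m = 2], [t = 3] and seven points; there the five dependent points of [S] lead to the singular
    cubic. *)
Lemma bound_rank5 A : (1 < m)%N -> prank P A = 5%N -> (m * #|A| <= 4 * t + 1)%N.
Proof.
move=> m2 rkA; have [//|[S [SA cardS rkS]]] := lgp_bound_or (j := 4) isT rkA.
have [x [y [_ _ xy]]] : exists x y, [/\ x \in S, y \in S & x != y].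
  by apply/card_gt1P; rewrite cardS.
have m2t := bound_pair xy.
have A7 : (#|A| <= 7)%N by have := card_le_prank A; rewrite rkA.
have [m3|m3] := leqP 3 m.
  by apply: leq_trans (_ : m * 7 <= _)%N; [rewrite leq_mul2l A7 orbT | lia].
have [A6|A6] := leqP #|A| 6.
  by apply: leq_trans (_ : m * 6 <= _)%N; [rewrite leq_mul2l A6 orbT | lia].
have cardA : #|A| = 7%N by lia.
rewrite cardA; have [t4|t4] := leqP 4 t; first by lia.
by case: (@hyperplane_five_bound A S) => //; lia.
Qed.

Lemma card_reduced : m = 1%N -> t = 1%N -> (#|I| <= n.+1)%N.
Proof.
move=> m1 t1; have := separates_dim P_neq0 mt sepP => -[V [_]].
by move: (\dim V) => d; rewrite m1 t1 !add1n subn1 /= binn binSn muln1; lia.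
Qed.

Lemma lower_bound A : (1 < prank P A)%N -> (m * #|A| <= (prank P A - 1) * t + 1)%N.
Proof.
move=> rkA; have [x [y [_ _ xy]]] : exists x y, [/\ x \in A, y \in A & x != y].
  by apply/card_gt1P; apply: leq_trans rkA (prank_le_card P A).
have m2t := bound_pair xy; have m0 : (0 < m)%N by case/andP: mt.
have cardA := card_le_prank A.
have [m1|m1] := eqVneq m 1%N.
  (* For [m = t = 1] separation makes all points independent; for larger [t],
     [#|A| <= prank P A + 2] suffices from rank three on. *)
  have [t1|t1] := eqVneq t 1%N.
    have := card_reduced m1 t1; have := prank_nullity A; rewrite P_full m1 t1; lia.
  have [rk2|rk2] := eqVneq (prank P A) 2%N; first by rewrite rk2 mul1n bound_rank2.
  rewrite m1 mul1n; have : (2 <= t)%N by lia.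
  by move: cardA rkA rk2; move: (prank P A) #|A| => r q; clear; nia.
have m2 : (1 < m)%N by lia.
have [rk2|rk2] := eqVneq (prank P A) 2%N; first by rewrite rk2 mul1n bound_rank2.
have [rk3|rk3] := eqVneq (prank P A) 3%N; first by rewrite rk3 bound_rank3.
have [rk4|rk4] := eqVneq (prank P A) 4%N; first by rewrite rk4 bound_rank4.
have [rk5|rk5] := eqVneq (prank P A) 5%N; first by rewrite rk5 bound_rank5.
(* From rank six on, the inequality for pairs and [#|A| <= r + 3] already suffice. *)
have [r [rE r5]] : exists r, prank P A = r.+1 /\ (5 <= r)%N.
  by exists (prank P A).-1; lia.
rewrite rE subn1 /= in cardA *.
apply: leq_trans (_ : m * (r + 3) <= _)%N; first by rewrite leq_mul2l; apply/orP; right; lia.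
apply: leq_trans (_ : r * (2 * m - 1) + 1 <= _)%N; last first.
  by rewrite leq_add2r leq_mul2l; apply/orP; right; lia.
by move: r5 m2; clear; nia.
Qed.

End LowerBound.

(** * The regularity index and Segre's bound *)

Lemma prank_pair (K : fieldType) (n s : nat) (P : 'I_s -> 'rV[K]_n.+1) i j :
  distinct_points P -> i != j -> prank P [set i; j] = 2%N.
Proof.
move=> [P0 P_inj] ij; apply/eqP; rewrite eqn_leq; apply/andP; split.
  by apply: leq_trans (prank_le_card _ _) _; rewrite cards2 ij.
rewrite leqNgt; apply: contra ij => rk1; apply/eqP/P_inj.
have sub_pt k : k \in [set i; j] -> (pspan P [set i; j] <= P k)%MS.
  move=> kij; have [_ <-] := mxrank_leqif_sup (pspan_sub P kij).
  by rewrite eqn_leq mxrankS ?pspan_sub //= rank_rV P0.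
by rewrite !(submx_trans (pspan_sub P _) (sub_pt _ _)) ?set21 ?set22.
Qed.

Lemma leq_floor m q j t : (0 < j)%N ->
  ((m * q + j - 2) %/ j <= t)%N <-> (m * q <= j * t + 1)%N.
Proof.
by move=> j0; rewrite -ltnS ltn_divLR // mulSn (mulnC t); split; lia.
Qed.

(** A set on a [j]-dimensional subspace is governed by its own span, since the inequality weakens as
    [j] grows; sets with at most one point only ask for [m <= t.+1]. *)
Lemma T_max_leP (K : fieldType) (n s m t : nat) (P : 'I_s -> 'rV[K]_n.+1) :
  distinct_points P -> (m <= t.+1)%N ->
  (T_max P m <= t)%N <->
  (forall A, (1 < prank P A)%N -> (m * #|A| <= (prank P A - 1) * t + 1)%N).
Proof.
move=> P_distinct mt; split=> [T_le A rkA|segre].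
  have rk_le : (prank P A <= n.+1)%N by exact: rank_leq_col.
  apply/leq_floor; first by lia.
  set j := (prank P A - 1)%N; have jn : (0 < j < n.+1)%N by rewrite /j; lia.
  apply: leq_trans T_le; apply: leq_trans (_ : T_ P m j <= _)%N; last first.
    by apply: leq_bigmax_seq => //; rewrite mem_index_iota.
  rewrite /T_; apply: (leq_bigmax_cond (F := fun A : {set 'I_s} => ((m * #|A| + j - 2) %/ j)%N)).
  apply/asboolP; exists (pspan P A); split; last by move=> i; exact: pspan_sub.
  by rewrite -/(prank P A) /j; lia.
rewrite /T_max big_seq; apply/bigmax_leqP_seq => j _; rewrite mem_index_iota => /andP[j0 jn].
apply/bigmax_leqP => A /asboolP[W [rkW AW]]; apply/leq_floor => //.
have rkA : (prank P A <= j.+1)%N by rewrite -rkW; apply/mxrankS/pspan_subP.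
have [rk2|rk1] := ltnP 1 (prank P A).
  apply: leq_trans (segre A rk2) _; rewrite leq_add2r leq_mul2r.
  by apply/orP; right; lia.
have A1 : (#|A| <= 1)%N.
  rewrite leqNgt; apply: contraTN rk1 => /card_gt1P[x [y [xA yA xy]]].
  rewrite -ltnNge -(prank_pair P_distinct xy).
  by apply: prankS; rewrite subUset !sub1set xA.
apply: leq_trans (_ : m * 1 <= _)%N; first by rewrite leq_mul2l A1 orbT.
by rewrite muln1 addn1; apply: leq_trans mt _; rewrite ltnS leq_pmull.
Qed.

Theorem theorem4p3 (K : closedFieldType) (n s m : nat)
    (P : 'I_s -> 'rV[K]_n.+1)
    (n_gt0 : (0 < n)%N) (m_gt0 : (0 < m)%N)
    (P_distinct : distinct_points P)
    (P_nondegenerate : nondegenerate_points P)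
    (s_le : (s <= n + 3)%N) :
  is_regularity_index P (fun _ => m) (T_max P m).
Proof.
have P_full : prank P setT = n.+1.
  apply/eqP; rewrite eqn_leq rank_leq_col -(eqP P_nondegenerate); apply: mxrankS.
  by apply/row_subP => i; rewrite rowK pspan_sub.
have s2 : (n.+1 <= s)%N by rewrite -P_full -[X in (_ <= X)%N]card_ord -cardsT prank_le_card.
have s0 : (0 < s)%N by apply: leq_trans s2.
have P_pair (i j : 'I_s) : i != j -> prank P [set i; j] = 2%N by exact: prank_pair.
have P0 : forall i, P i != 0 by case: P_distinct.
have quotE t := quotient_dim_separates t P0 n_gt0 m_gt0 s0.
have cardI : (#|'I_s| <= n + 3)%N by rewrite card_ord.
split=> [|t /quotE[mt sepP]]; last first.
  apply/T_max_leP => // A; apply: lower_bound => //; last by rewrite m_gt0.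
  exact: closed_field_infinite.
have [i [j [_ _ ij]]] : exists i j : 'I_s, [/\ i \in [set: 'I_s], j \in [set: 'I_s] & i != j].
  by apply/card_gt1P; rewrite cardsT card_ord; apply: leq_trans s2.
(* The line through two of the points gives [2 * m - 1 <= T_max P m]. *)
have T_ge : (m <= (T_max P m).+1)%N.
  have j1 : on_linear_subspace P [set i; j] 1.
    by exists (pspan P [set i; j]); split; [exact: P_pair | move=> k; exact: pspan_sub].
  have : ((m * #|[set i; j]| + 1 - 2) %/ 1 <= T_max P m)%N.
    apply: leq_trans (_ : T_ P m 1 <= _)%N; last first.
      by apply: leq_bigmax_seq => //; rewrite mem_index_iota; apply/andP; split.
    rewrite /T_; apply: (leq_bigmax_cond (F := fun A : {set 'I_s} => ((m * #|A| + 1 - 2) %/ 1)%N)).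
    exact/asboolP.
  by rewrite divn1 cards2 ij; lia.
apply/quotE; split=> //; apply: segre_separates => //.
  by rewrite P_full card_ord; lia.
by apply/T_max_leP.
Qed.
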